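(* Let $W$ be a complex vector space, $k\le\dim W-k$, and $3\le s\le k-s$. For $z\in\Lambda^kW$ let $z_{s,k-s}:\Lambda^sW^*\to\Lambda^{k-s}W$ be the skew-flattening (contraction). Then $\sigma_3(G(k,W))\subset\mathbb{P}\Lambda^kW$ is an irreducible component of the zero set of the minors of size $3\binom{k}{s}+1$ of $z_{s,k-s}$.
   Context: $G(k,W)\subset\mathbb{P}\Lambda^kW$ is the Grassmannian of $k$-planes in its Plücker embedding (classes of decomposable $k$-vectors); for a decomposable $z$, $\operatorname{rank}z_{s,k-s}=\binom ks$. $\sigma_3$ denotes the third secant variety (Zariski closure of the union of planes spanned by three points). *)

(* Defs.v *)
From HB Require Import structures.
From mathcomp Require Import all_boot all_order all_algebra.
From mathcomp Require Import reals.
From mathcomp Require Import complex.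

Set Implicit Arguments. Unset Strict Implicit. Unset Printing Implicit Defensive.
Import Order.TTheory GRing.Theory Num.Theory.
Local Open Scope ring_scope.

(* W = F^n with standard basis e_0..e_{n-1}.  Lambda^k W has basis e_S,
   S a k-subset of 'I_n, e_S = e_{s_1} /\ ... /\ e_{s_k} with s_1<...<s_k. *)
Definition ksub (n k : nat) := {S : {set 'I_n} | #|S| == k}.

Definition wedge (F : nzRingType) (n k : nat) := {ffun ksub n k -> F}.

Inductive polyfun (F : nzRingType) (I : finType) : ({ffun I -> F} -> F) -> Prop :=
| pf_const (c : F) : polyfun (fun _ => c)
| pf_coord (i : I) : polyfun (fun x => x i)
| pf_add p q : polyfun p -> polyfun q -> polyfun (fun x => p x + q x)
| pf_mul p q : polyfun p -> polyfun q -> polyfun (fun x => p x * q x).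

Definition zclosed (F : nzRingType) (I : finType) (A : {ffun I -> F} -> Prop) :=
  exists P : ({ffun I -> F} -> F) -> Prop,
    (forall p, P p -> polyfun p) /\
    (forall x, A x <-> (forall p, P p -> p x = 0)).

Definition zclosure (F : nzRingType) (I : finType) (A : {ffun I -> F} -> Prop)
  : {ffun I -> F} -> Prop :=
  fun x => forall p, polyfun p -> (forall y, A y -> p y = 0) -> p x = 0.

Definition zirreducible (F : nzRingType) (I : finType) (X : {ffun I -> F} -> Prop) :=
  (exists x, X x) /\
  forall F1 F2 : {ffun I -> F} -> Prop, zclosed F1 -> zclosed F2 ->
    (forall x, X x -> F1 x \/ F2 x) ->
    (forall x, X x -> F1 x) \/ (forall x, X x -> F2 x).

Definition irreducible_component (F : nzRingType) (I : finType)
    (X Z : {ffun I -> F} -> Prop) :=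
  [/\ zirreducible X, (forall x, X x -> Z x) &
      forall Y, zirreducible Y -> (forall x, X x -> Y x) ->
        (forall x, Y x -> Z x) -> forall x, Y x -> X x].

(* the j-th smallest element of a k-subset S *)
Definition ksub_elt n k (S : ksub n k) (j : 'I_k) : 'I_n :=
  @enum_val _ (mem (val S)) (cast_ord (esym (eqP (valP S))) j).

(* Plucker coordinates of w_1 /\ ... /\ w_k, w_i = i-th row of M *)
Definition plucker (F : comNzRingType) n k (M : 'M[F]_(k, n)) : wedge F n k :=
  [ffun S => \det (colsub (ksub_elt S) M)].

Definition grass_cone (F : comNzRingType) n k (z : wedge F n k) :=
  exists M : 'M[F]_(k, n), z = plucker M.

Definition sigma3_cone (F : comNzRingType) n k : wedge F n k -> Prop :=
  zclosure (fun z => exists z1 z2 z3, [/\ grass_cone z1, grass_cone z2,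
                     grass_cone z3 & z = z1 + z2 + z3]).

Definition wcoord (F : nzRingType) n k (z : wedge F n k) (S : {set 'I_n}) : F :=
  if insub S is Some S' then z S' else 0.

(* number of pairs (a,b) in A x B with b < a: sign of e_A /\ e_B vs e_{A u B} *)
Definition ninv n (A B : {set 'I_n}) : nat :=
  #|[set p : 'I_n * 'I_n | [&& p.1 \in A, p.2 \in B & (p.2 < p.1)%N]]|.

(* matrix entry: <e_B^*, e_A^* _| z> = sign * z_{A u B} *)
Definition skewflat (F : nzRingType) n k s (z : wedge F n k)
    (A : ksub n s) (B : ksub n (k - s)) : F :=
  if [disjoint val A & val B] then
    (-1) ^+ ninv (val A) (val B) * wcoord z (val A :|: val B)
  else 0.

Definition flat_minor (F : comNzRingType) n k s r (f : 'I_r -> ksub n s)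
    (g : 'I_r -> ksub n (k - s)) (z : wedge F n k) : F :=
  \det (\matrix_(i < r, j < r) skewflat z (f i) (g j)).

Definition minors_zero (F : comNzRingType) n k s r (z : wedge F n k) : Prop :=
  forall (f : 'I_r -> ksub n s) (g : 'I_r -> ksub n (k - s)),
    injective f -> injective g -> flat_minor f g z = 0.

(* Main.v *)
Require Import Defs.
From HB Require Import structures.
From mathcomp Require Import all_boot all_order all_algebra all_fingroup.
From mathcomp Require Import ring zify.
From mathcomp Require Import boolp reals.
From mathcomp Require Import complex.
Set Implicit Arguments. Unset Strict Implicit. Unset Printing Implicit Defensive.
Import Order.TTheory GRing.Theory Num.Theory.
Local Open Scope ring_scope.

(* A decomposable vector has a flattening of rank at most 'C(k, s), so sigma_3 lies
   in the locus Z of the minors. Conversely, at one point z0 of sigma_3 the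
   flattening has rank exactly 3 'C(k, s), and the linear parts of the minors at z0
   are the forms z |-> <z, a /\ b> with a, b in the two kernels of the flattening of
   z0. They cut out exactly the tangent directions of sigma_3: in the basis adapted
   to z0 (blocks of two indices 2l, 2l+1), a vector killed by all these forms has
   coordinates that are an affine function of the set of even choices when no block
   is missed (away from the sets of corank or rank at most one), constant when one
   block is missed, and zero when two blocks are missed.
   Equality of tangent spaces suffices: if p vanishes on sigma_3, then p lies in
   every power of the maximal ideal of the local ring of Z at z0, hence is zero
   there by Krull's intersection theorem; so h p = 0 on Z for some h with
   h(z0) <> 0, and an irreducible subset of Z containing sigma_3 lies in {p = 0}. *)

(** * Noetherian rings *)

(** The criterion replaces a dimension count: it only asks that every vector killed by the linear
    parts of the minors be the velocity of a curve of sums of three decomposable vectors, and such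
    curves arise by moving three matrices along lines. Polynomials occur only as functions, so the
    local ring at z0 is imitated by multiplying with functions h such that h(z0) <> 0, and
    finiteness is imported from an iterated polynomial ring. The third summand of z0 has coordinate
    1 at every choice of one index per block; the other two only affect the all-even and the all-odd
    choice. Hence changing one choice leaves the coordinate unchanged as soon as an even and an odd
    choice are fixed elsewhere, so the kernels contain differences of two basis vectors and the
    forms become difference equations on the cube of choices. A mixed second difference needs, on
    each side of the splitting, the index to be changed and two such witnesses: this is 3 <= s and 3
    <= k - s. Two indices per block account for 2k <= n. *)

Section Noetherian.

Definition is_ideal (R : comNzRingType) (J : R -> Prop) :=
  [/\ J 0, (forall x y, J x -> J y -> J (x + y)) & (forall a x, J x -> J (a * x))].

(** Encoded as the intersection of all ideals containing [s]; membership is used by instantiating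
    [J], without lists of coefficients. *)
Definition ideal_gen (R : comNzRingType) (s : seq R) (x : R) :=
  forall J : R -> Prop, is_ideal J -> (forall y, y \in s -> J y) -> J x.

Definition noetherian (R : comNzRingType) :=
  forall J : R -> Prop, is_ideal J ->
    exists s : seq R, (forall x, x \in s -> J x) /\ forall x, J x -> ideal_gen s x.

Lemma ideal_gen_ideal (R : comNzRingType) (s : seq R) : is_ideal (ideal_gen s).
Proof.
split=> [J [] //|x y Hx Hy J iJ sJ|a x Hx J iJ sJ]; have [_ JD JM] := iJ.
  by apply: JD; [apply: Hx | apply: Hy].
by apply: JM; apply: Hx.
Qed.

Lemma ideal_gen_sub (R : comNzRingType) (s t : seq R) x :
  {subset s <= t} -> ideal_gen s x -> ideal_gen t x.
Proof. by move=> st sx J iJ tJ; apply: sx => // y /st; apply: tJ. Qed.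

Lemma ideal_gen_mem (R : comNzRingType) (s : seq R) x : x \in s -> ideal_gen s x.
Proof. by move=> xs J _; apply. Qed.

Lemma field_noetherian (F : fieldType) : noetherian F.
Proof.
move=> J [J0 JD JM].
case: (lem (exists2 x, J x & x != 0)) => [[x Jx x0]|N].
  exists [:: x]; split=> [y|y _]; first by rewrite inE => /eqP ->.
  move=> K [_ _ KM] Kx; rewrite -(divfK x0 y).
  by apply: KM; apply: Kx; rewrite inE.
exists [::]; split=> // x Jx K [K0 _ _] _.
by case: (eqVneq x 0) => [->|x0] //; case: N; exists x.
Qed.

Section HilbertBasis.
Variables (R : comNzRingType) (J : {poly R} -> Prop).
Hypotheses (RN : noetherian R) (iJ : is_ideal J).

(** The ideal of leading coefficients in degree [n]. Bounding the size, instead of fixing it, lets 0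
    in. *)
Let lead n (a : R) := exists p, [/\ J p, (size p <= n.+1)%N & p`_n = a].

Let lead_ideal n : is_ideal (lead n).
Proof.
have [J0 JD JM] := iJ; split.
- by exists 0; split; rewrite ?size_poly0 ?coef0.
- move=> x y [p [Jp sp <-]] [q [Jq sq <-]]; exists (p + q); split.
  + exact: JD.
  + by rewrite (leq_trans (size_polyD _ _)) // geq_max sp.
  + by rewrite coefD.
- move=> a x [p [Jp sp <-]]; exists (a%:P * p); split; first exact: JM.
  + by rewrite mul_polyC (leq_trans (size_scale_leq _ _)).
  + by rewrite coefCM.
Qed.

Let lead_mono n m a : (n <= m)%N -> lead n a -> lead m a.
Proof.
have [_ _ JM] := iJ => nm [p [Jp sp <-]]; exists ('X^(m - n) * p); split.
- exact: JM.
- rewrite mulrC; have [->|p0] := eqVneq p 0; first by rewrite mul0r size_poly0.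
  by rewrite size_mulXn //; lia.
- by rewrite coefXnM ltnNge leq_subr /= subKn.
Qed.

Let lead_lift n t : (forall a, a \in t -> lead n a) ->
  exists s : seq {poly R}, (forall p, p \in s -> J p) /\
   forall a, ideal_gen t a ->
     exists q, [/\ ideal_gen s q, (size q <= n.+1)%N & q`_n = a].
Proof.
move=> tn.
have [s [sJ st]] : exists s : seq {poly R}, (forall p, p \in s -> J p) /\
   forall a, a \in t -> exists q, [/\ q \in s, (size q <= n.+1)%N & q`_n = a].
  elim: t tn => [|b t IH] tn; first by exists [::].
  have [|s [sJ st]] := IH.
    by move=> a ta; apply: tn; rewrite inE ta orbT.
  have [|p [Jp sp pn]] := tn b; first by rewrite mem_head.
  exists (p :: s); split=> [q|a].
    by rewrite inE => /orP[/eqP -> //|/sJ].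
  rewrite inE => /orP[/eqP ->|/st[q [sq ? ?]]].
    by exists p; rewrite mem_head.
  by exists q; rewrite inE sq orbT.
exists s; split=> // a ga.
refine (ga (fun a => exists q, [/\ ideal_gen s q, (size q <= n.+1)%N & q`_n = a]) _ _).
  have [J0 JD JM] := ideal_gen_ideal s; split.
  - by exists 0; split; rewrite ?size_poly0 ?coef0.
  - move=> x y [p [Jp sp <-]] [q [Jq sq <-]]; exists (p + q); split.
    + exact: JD.
    + by rewrite (leq_trans (size_polyD _ _)) // geq_max sp.
    + by rewrite coefD.
  - move=> b x [p [Jp sp <-]]; exists (b%:P * p); split; first exact: JM.
    + by rewrite mul_polyC (leq_trans (size_scale_leq _ _)).
    + by rewrite coefCM.
move=> y /st[q [sq ? ?]]; exists q; split=> //; exact: ideal_gen_mem.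
Qed.

(** One division step: modulo the ideal generated by [s], the degree drops below [n]. *)
Let reduces n s := forall p, J p -> (size p <= n.+1)%N ->
  exists q, [/\ ideal_gen s q, J q & (size (p - q)%R <= n)%N].

Let gen_sub s q : (forall p, p \in s -> J p) -> ideal_gen s q -> J q.
Proof. by move=> sJ; apply. Qed.

Let size_reduce n (p q : {poly R}) :
  (size p <= n.+1)%N -> (size q <= n.+1)%N -> q`_n = p`_n -> (size (p - q)%R <= n)%N.
Proof.
move=> sp sq e; apply/leq_sizeP => j; rewrite leq_eqVlt => /orP[/eqP <-|nj].
  by rewrite coefB e subrr.
by rewrite coefB !(nth_default _ (leq_trans _ nj)) ?subrr.
Qed.

Let reduces_each n : exists s : seq {poly R}, (forall p, p \in s -> J p) /\ reduces n s.
Proof.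
have [t [tn tg]] := RN (lead_ideal n).
have [s [sJ sq]] := lead_lift tn; exists s; split=> // p Jp sp.
have [|q [gq szq qn]] := sq p`_n; first by apply: tg; exists p.
by exists q; split=> //; [exact: gen_sub sJ gq | exact: size_reduce].
Qed.

(** The increasing union of the ideals [lead n] is finitely generated, so its generators already lie
    in one [lead d]. Multiplying their lifts by powers of 'X serves all degrees from [d] on. *)
Let reduces_large : exists (d : nat) (s : seq {poly R}), (forall p, p \in s -> J p) /\
  forall n, (d <= n)%N -> reduces n s.
Proof.
have [_ _ JM] := iJ.
have linf_ideal : is_ideal (fun a => exists n, lead n a).
  split; first by exists 0%N; have [] := lead_ideal 0.
    move=> x y [n nx] [m my]; exists (maxn n m).
    have [_ LD _] := lead_ideal (maxn n m).
    by apply: LD; [apply: lead_mono nx | apply: lead_mono my]; lia.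
  by move=> a x [n nx]; exists n; have [_ _ LM] := lead_ideal n; apply: LM.
have [t [tn tg]] := RN linf_ideal.
have [d td] : exists d, forall a, a \in t -> lead d a.
  elim: t tn {tg} => [|b t IH] tn; first by exists 0%N.
  have [|d td] := IH; first by move=> a ta; apply: tn; rewrite inE ta orbT.
  have [|n nb] := tn b; first by rewrite mem_head.
  exists (maxn n d) => a; rewrite inE => /orP[/eqP ->|/td].
    by apply: lead_mono nb; lia.
  by apply: lead_mono; lia.
have [s [sJ sq]] := lead_lift td; exists d, s; split=> // n dn p Jp sp.
have [|q [gq szq qn]] := sq p`_n; first by apply: tg; exists n, p.
have [_ _ GM] := ideal_gen_ideal s.
exists ('X^(n - d) * q); split; first exact: GM.
  by apply: JM; exact: gen_sub sJ gq.
apply: size_reduce => //.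
  rewrite mulrC; have [->|q0] := eqVneq q 0; first by rewrite mul0r size_poly0.
  by rewrite size_mulXn //; lia.
by rewrite coefXnM ltnNge leq_subr /= subKn.
Qed.

Lemma hilbert_basis_ideal :
  exists s, (forall x, x \in s -> J x) /\ forall x, J x -> ideal_gen s x.
Proof.
have [_ JD JM] := iJ.
have [d [s [sJ sr]]] := reduces_large.
(* The finitely many degrees below [d] each contribute their own generators. *)
have [t [tJ tr]] : exists t : seq {poly R}, (forall p, p \in t -> J p) /\
    forall n, (n < d)%N -> reduces n t.
  elim: d {sr} => [|d [t [tJ tr]]]; first by exists [::].
  have [u [uJ ur]] := reduces_each d.
  exists (t ++ u); split=> [p|n].
    by rewrite mem_cat => /orP[/tJ|/uJ].
  rewrite ltnS leq_eqVlt => /orP[/eqP ->|nd] p Jp sp.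
    have [q [gq Jq sq]] := ur p Jp sp; exists q; split=> //.
    by apply: ideal_gen_sub gq => x; rewrite mem_cat orbC => ->.
  have [q [gq Jq sq]] := tr n nd p Jp sp; exists q; split=> //.
  by apply: ideal_gen_sub gq => x; rewrite mem_cat => ->.
exists (s ++ t); split=> [p|p].
  by rewrite mem_cat => /orP[/sJ|/tJ].
have [G0 GD _] := ideal_gen_ideal (s ++ t).
have [n] := ubnP (size p); elim: n p => [//|n IH] p sp Jp.
case: n IH sp => [|n] IH sp.
  by move: sp; rewrite ltnS leqn0 size_poly_eq0 => /eqP ->.
have [q [gq Jq sq]] : exists q,
    [/\ ideal_gen (s ++ t) q, J q & (size (p - q)%R <= n)%N].
  have [dn|nd] := leqP d n.
    have [q [gq Jq sq]] := sr n dn p Jp sp; exists q; split=> //.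
    by apply: ideal_gen_sub gq => x; rewrite mem_cat => ->.
  have [q [gq Jq sq]] := tr n nd p Jp sp; exists q; split=> //.
  by apply: ideal_gen_sub gq => x; rewrite mem_cat orbC => ->.
rewrite -(subrK q p); apply: (GD) => //.
apply: IH; first by rewrite ltnS.
by apply: JD => //; rewrite -mulN1r; apply: JM.
Qed.

End HilbertBasis.

Lemma hilbert_basis (R : comNzRingType) : noetherian R -> noetherian {poly R}.
Proof. by move=> RN J iJ; exact: hilbert_basis_ideal. Qed.

(** The union of the ideals spanned by initial segments of [f] is finitely generated, hence equal to
    one [span d], which then contains [f d]. *)
Lemma noetherian_seq (R : comNzRingType) (f : nat -> R) : noetherian R ->
  exists n (c : nat -> R), f n = \sum_(i < n) c i * f i.
Proof.
move=> RN.
pose span n x := exists c : nat -> R, x = \sum_(i < n) c i * f i.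
have span_ideal n : is_ideal (span n).
  split; first by exists (fun=> 0); rewrite big1 // => i _; rewrite mul0r.
    move=> x y [c ->] [e ->]; exists (fun i => c i + e i).
    by rewrite -big_split; apply: eq_bigr => i _; rewrite mulrDl.
  move=> a x [c ->]; exists (fun i => a * c i).
  by rewrite mulr_sumr; apply: eq_bigr => i _; rewrite mulrA.
have span_mono n m x : (n <= m)%N -> span n x -> span m x.
  move=> nm [c ->]; exists (fun i => if (i < n)%N then c i else 0).
  rewrite (big_ord_widen m (fun i => c i * f i) nm) big_mkcond.
  by apply: eq_bigr => i _; case: ifP => //; rewrite mul0r.
have iJ : is_ideal (fun x => exists n, span n x).
  split; first by exists 0%N; have [] := span_ideal 0%N.
    move=> x y [n nx] [m my]; exists (maxn n m).
    have [_ LD _] := span_ideal (maxn n m).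
    by apply: LD; [apply: span_mono nx | apply: span_mono my]; lia.
  by move=> a x [n nx]; exists n; have [_ _ LM] := span_ideal n; apply: LM.
have [t [tn tg]] := RN _ iJ.
have [d td] : exists d, forall a, a \in t -> span d a.
  elim: t tn {tg} => [|b t IH] tn; first by exists 0%N.
  have [|d td] := IH; first by move=> a ta; apply: tn; rewrite inE ta orbT.
  have [|n nb] := tn b; first by rewrite mem_head.
  exists (maxn n d) => a; rewrite inE => /orP[/eqP ->|/td].
    by apply: span_mono nb; lia.
  by apply: span_mono; lia.
exists d; refine (tg (f d) _ _ (span_ideal d) td).
exists d.+1, (fun i => (i == d)%:R).
rewrite big_ord_recr /= eqxx mul1r big1 ?add0r // => i _.
by rewrite (ltn_eqF (ltn_ord i)) mul0r.
Qed.

End Noetherian.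

(** * Polynomial rings in finitely many variables and their evaluations *)

Section IteratedPoly.
Variable F : fieldType.

Fixpoint iter_poly (m : nat) : comNzRingType :=
  if m is m'.+1 then {poly iter_poly m'} else F.

Lemma iter_poly_noetherian m : noetherian (iter_poly m).
Proof. by elim: m => [|m IH]; [exact: field_noetherian | exact: hilbert_basis]. Qed.

Section Eval.
Variables (S : comNzRingType) (iota : {rmorphism F -> S}) (al : nat -> S).

(** [al j] is the value of the variable adjoined at stage [j]. *)
Fixpoint iter_eval (m : nat) : {rmorphism iter_poly m -> S} :=
  if m is m'.+1 then
    horner_morph ((fun x => mulrC _ _) : commr_rmorph (iter_eval m') (al m'))
  else iota.
End Eval.
End IteratedPoly.

(** * Polynomial functions and order of vanishing *)

Section PolynomialFunctions.
Variables (F : fieldType) (I : finType).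
Notation V := {ffun I -> F}.
Implicit Types (p q : V -> F).

Lemma polyfun_opp p : polyfun p -> polyfun (fun x => - p x).
Proof.
move=> pp; rewrite (_ : (fun x => - p x) = (fun x => (-1) * p x)).
  by apply: pf_mul => //; apply: pf_const.
by apply/funext => x; rewrite mulN1r.
Qed.

Lemma polyfun_sub p q : polyfun p -> polyfun q -> polyfun (fun x => p x - q x).
Proof. by move=> pp pq; apply: pf_add => //; apply: polyfun_opp. Qed.

Lemma polyfun_sum (J : Type) (s : seq J) (P : pred J) (f : J -> V -> F) :
  (forall j, polyfun (f j)) -> polyfun (fun x => \sum_(j <- s | P j) f j x).
Proof.
move=> pf; elim: s => [|j s IH].
  by rewrite (_ : (fun x => _) = (fun=> 0)); [apply: pf_const | apply/funext => x; rewrite big_nil].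
rewrite (_ : (fun x => _) =
  (fun x => (if P j then f j x else 0) + \sum_(j <- s | P j) f j x)).
  apply: pf_add => //; case: (P j) => //; exact: pf_const.
by apply/funext => x; rewrite big_cons; case: (P j); rewrite ?add0r.
Qed.

Lemma polyfun_prod (J : Type) (s : seq J) (P : pred J) (f : J -> V -> F) :
  (forall j, polyfun (f j)) -> polyfun (fun x => \prod_(j <- s | P j) f j x).
Proof.
move=> pf; elim: s => [|j s IH].
  by rewrite (_ : (fun x => _) = (fun=> 1)); [apply: pf_const | apply/funext => x; rewrite big_nil].
rewrite (_ : (fun x => _) =
  (fun x => (if P j then f j x else 1) * \prod_(j <- s | P j) f j x)).
  apply: pf_mul => //; case: (P j) => //; exact: pf_const.
by apply/funext => x; rewrite big_cons; case: (P j); rewrite ?mul1r.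
Qed.

Lemma polyfun_det m (A : V -> 'M[F]_m) :
  (forall i j, polyfun (fun x => A x i j)) -> polyfun (fun x => \det (A x)).
Proof.
move=> pA; apply: polyfun_sum => s; apply: pf_mul; first exact: pf_const.
exact: polyfun_prod.
Qed.

Lemma polyfun_curve p (g : I -> {poly F}) : polyfun p ->
  exists P : {poly F}, forall t, p [ffun i => (g i).[t]] = P.[t].
Proof.
elim=> [c|i|p1 p2 _ [P1 h1] _ [P2 h2]|p1 p2 _ [P1 h1] _ [P2 h2]].
- by exists c%:P => t; rewrite hornerC.
- by exists (g i) => t; rewrite ffunE.
- by exists (P1 + P2) => t; rewrite hornerD h1 h2.
- by exists (P1 * P2) => t; rewrite hornerM h1 h2.
Qed.

End PolynomialFunctions.

(** * Powers of the maximal ideal at a point *)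

Section OrderOfVanishing.
Variables (F : fieldType) (I : finType).
Notation V := {ffun I -> F}.
Implicit Types (p q L Q : V -> F).

(** Generated by expressions, in parallel with [polyfun]. The zero function belongs to every degree
    because a leading form may vanish. *)
Inductive homogeneous : nat -> (V -> F) -> Prop :=
| homog_zero r : homogeneous r (fun=> 0)
| homog_const c : homogeneous 0 (fun=> c)
| homog_coord i : homogeneous 1 (fun v => v i)
| homog_add r p q :
    homogeneous r p -> homogeneous r q -> homogeneous r (fun v => p v + q v)
| homog_mul r r' p q :
    homogeneous r p -> homogeneous r' q ->
    homogeneous (r + r') (fun v => p v * q v).

Variable z0 : V.

(* [vanishing r Q]: Q lies in the r-th power of the maximal ideal at z0. *)
Inductive vanishing : nat -> (V -> F) -> Prop :=
| vanishing_homog r c L : polyfun c -> homogeneous r L ->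
    vanishing r (fun z => c z * L (z - z0))
| vanishing_add r p q :
    vanishing r p -> vanishing r q -> vanishing r (fun z => p z + q z).

Lemma vanishing_of_homogeneous r L :
  homogeneous r L -> vanishing r (fun z => L (z - z0)).
Proof.
move=> hL; rewrite (_ : (fun z => _) = (fun z => 1 * L (z - z0))).
  exact: (vanishing_homog (@pf_const F I 1) hL).
by apply/funext => z; rewrite mul1r.
Qed.

Lemma vanishing_0 r : vanishing r (fun=> 0).
Proof. exact: (vanishing_of_homogeneous (homog_zero r)). Qed.

Lemma polyfun_vanishing0 p : polyfun p -> vanishing 0 p.
Proof.
move=> pp; rewrite (_ : p = (fun z => p z * (fun=> 1) (z - z0))).
  exact: (vanishing_homog pp (homog_const 1)).
by apply/funext => z; rewrite mulr1.
Qed.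

Lemma vanishing_mul r r' p q :
  vanishing r p -> vanishing r' q -> vanishing (r + r') (fun z => p z * q z).
Proof.
move=> hp hq; elim: hp q hq => {r p} [r c L pc hL q hq|r p1 p2 _ h1 _ h2 q hq].
  elim: hq => {r' q} [r' c' L' pc' hL'|r' q1 q2 _ h1 _ h2].
    rewrite (_ : (fun z => _) =
       (fun z => (c z * c' z) * (fun v => L v * L' v) (z - z0))).
      exact: (vanishing_homog (pf_mul pc pc') (homog_mul hL hL')).
    by apply/funext => z /=; rewrite mulrACA.
  rewrite (_ : (fun z => _) =
    fun z => c z * L (z - z0) * q1 z + c z * L (z - z0) * q2 z).
    exact: vanishing_add.
  by apply/funext => z; rewrite mulrDr.
rewrite (_ : (fun z => _) = fun z => p1 z * q z + p2 z * q z).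
  by apply: vanishing_add; [exact: h1 | exact: h2].
by apply/funext => z; rewrite mulrDl.
Qed.

Lemma vanishing_mull r c q :
  polyfun c -> vanishing r q -> vanishing r (fun z => c z * q z).
Proof. by move=> /polyfun_vanishing0 /vanishing_mul; apply. Qed.

Lemma vanishing_sum r (J : Type) (s : seq J) (f : J -> V -> F) :
  (forall j, vanishing r (f j)) -> vanishing r (fun x => \sum_(j <- s) f j x).
Proof.
move=> pf; elim: s => [|j s IH].
  rewrite (_ : (fun x => _) = (fun=> 0)); first exact: vanishing_0.
  by apply/funext => x; rewrite big_nil.
rewrite (_ : (fun x => _) = (fun x => f j x + \sum_(j <- s) f j x)).
  exact: vanishing_add.
by apply/funext => x; rewrite big_cons.
Qed.

Lemma vanishing_sub_value p : polyfun p -> vanishing 1 (fun z => p z - p z0).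
Proof.
elim=> [c|i|p1 p2 _ h1 _ h2|p1 p2 pp1 h1 pp2 h2].
- rewrite (_ : (fun z => _) = fun=> 0); first exact: vanishing_0.
  by apply/funext => z; rewrite subrr.
- rewrite (_ : (fun z => _) = fun z => (fun v : V => v i) (z - z0)).
    exact: (vanishing_of_homogeneous (homog_coord i)).
  by apply/funext => z; rewrite !ffunE.
- rewrite (_ : (fun z => _) = fun z => (p1 z - p1 z0) + (p2 z - p2 z0)).
    exact: vanishing_add.
  by apply/funext => z; ring.
- rewrite (_ : (fun z => _) =
    fun z => p2 z * (p1 z - p1 z0) + p1 z0 * (p2 z - p2 z0)).
    by apply: vanishing_add; apply: vanishing_mull => //; exact: pf_const.
  by apply/funext => z; ring.
Qed.

(** Freeze each coefficient [c] at its value [c z0]: the difference [c - c z0] vanishes at [z0] and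
    gains one order. *)
Lemma vanishing_leading_form r Q : vanishing r Q ->
  exists2 L, homogeneous r L & vanishing r.+1 (fun z => Q z - L (z - z0)).
Proof.
elim=> {r Q} [r c L pc hL|r p q _ [L1 h1 v1] _ [L2 h2 v2]].
  exists (fun v => c z0 * L v).
    exact: (homog_mul (homog_const _) hL).
  rewrite (_ : (fun z => _) = fun z => (c z - c z0) * (L (z - z0))).
    exact: (vanishing_mul (vanishing_sub_value pc) (vanishing_of_homogeneous hL)).
  by apply/funext => z; rewrite mulrBl.
exists (fun v => L1 v + L2 v); first exact: homog_add.
rewrite (_ : (fun z => _) =
  fun z => (p z - L1 (z - z0)) + (q z - L2 (z - z0))).
  exact: vanishing_add.
by apply/funext => z; ring.
Qed.

Section Curve.
Variable g : I -> {poly F}.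
Hypothesis g0 : forall i, (g i)`_0 = z0 i.
Let gam t : V := [ffun i => (g i).[t]].

Lemma homogeneous_curve r L : homogeneous r L ->
  exists2 P : {poly F}, (forall t, L (gam t - z0) = t ^+ r * P.[t])
    & P.[0] = L [ffun i => (g i)`_1].
Proof.
elim=> {r L} [r|c|i|r p q _ [P1 h1 e1] _ [P2 h2 e2]|r r' p q _ [P1 h1 e1] _ [P2 h2 e2]].
- by exists 0 => [t|]; rewrite horner0 ?mulr0.
- by exists c%:P => [t|]; rewrite hornerC // expr0 mul1r.
(* This is the quotient of [g i - z0 i] by 'X; its value at 0 is the velocity. *)
- exists (\poly_(j < (size (g i)).-1) (g i)`_j.+1) => [t|]; last first.
    by rewrite horner_coef0 coef_poly !ffunE; case: ltnP => // h;
      rewrite nth_default //; case: (size (g i)) h => [|[]].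
  rewrite !ffunE horner_poly horner_coef; case e : (size (g i)) => [|m].
    rewrite !big_ord0 mulr0 sub0r -g0 nth_default ?e ?oppr0 //.
  rewrite big_ord_recl expr0 mulr1 -g0 addrAC subrr add0r mulr_sumr.
  by apply: eq_bigr => j _; rewrite /= expr1 exprS mulrCA.
- by exists (P1 + P2) => [t|]; rewrite hornerD ?h1 ?h2 ?mulrDr // e1 e2.
- exists (P1 * P2) => [t|]; rewrite hornerM ?h1 ?h2 ?e1 ?e2 //.
  by rewrite exprD mulrACA.
Qed.

Lemma vanishing_curve r Q : vanishing r Q ->
  exists P : {poly F}, forall t, Q (gam t) = t ^+ r * P.[t].
Proof.
elim=> {r Q} [r c L pc hL|r p q _ [P1 h1] _ [P2 h2]].
  have [P hP _] := homogeneous_curve hL; have [C hC] := polyfun_curve g pc.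
  by exists (C * P) => t; rewrite hP hC hornerM mulrCA.
by exists (P1 + P2) => t; rewrite h1 h2 hornerD mulrDr.
Qed.

End Curve.

(** * The Rees algebra and Krull's intersection theorem *)

Section Rees.

(* Generators z_i and (z_i - z0_i)T of the Rees algebra of the maximal ideal at z0. *)
Let gens (z : V) : seq {poly F} :=
  [seq (z i)%:P | i <- enum I] ++ [seq (z i - z0 i) *: 'X | i <- enum I].

Let m := (#|I| + #|I|)%N.
Let ev (z : V) : {rmorphism iter_poly F m -> {poly F}} :=
  iter_eval (polyC : {rmorphism F -> {poly F}}) (nth 0 (gens z)) m.

(** The family [g] comes from a single element of a Noetherian ring, so finite generation can be
    applied to that element and then specialised at every [z]. *)
Let rees (g : V -> {poly F}) := exists R, forall z, g z = ev z R.

Let iter_eval_const (S : comNzRingType) (iota : {rmorphism F -> S}) j (c : F) :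
  exists R, forall al, iter_eval iota al j R = iota c.
Proof.
elim: j => [|j [R hR]]; first by exists c.
by exists R%:P => al; rewrite /= horner_morphC.
Qed.

Let iter_eval_gen (S : comNzRingType) (iota : {rmorphism F -> S}) j i :
  (i < j)%N -> exists R, forall al, iter_eval iota al j R = al i.
Proof.
elim: j => [//|j IH]; rewrite ltnS leq_eqVlt => /orP[/eqP ->|/IH [R hR]].
  by exists 'X => al; rewrite /= horner_morphX.
by exists R%:P => al; rewrite /= horner_morphC.
Qed.

Let rees_const c : rees (fun=> c%:P).
Proof.
have [R hR] := iter_eval_const (polyC : {rmorphism F -> {poly F}}) m c.
by exists R => z; rewrite /ev hR.
Qed.

Let rees_coord i : rees (fun z => (z i)%:P).
Proof.
have hi : (index i (enum I) < #|I|)%N by rewrite cardE index_mem mem_enum.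
have [|R hR] := @iter_eval_gen _ (polyC : {rmorphism F -> {poly F}}) m (index i (enum I)).
  by rewrite /m; lia.
exists R => z; rewrite /ev hR nth_cat size_map -cardE hi.
by rewrite (nth_map i) ?nth_index ?mem_enum // -cardE.
Qed.

Let rees_param i : rees (fun z => (z i - z0 i) *: 'X).
Proof.
have hi : (index i (enum I) < #|I|)%N by rewrite cardE index_mem mem_enum.
have [|R hR] := @iter_eval_gen _ (polyC : {rmorphism F -> {poly F}}) m (#|I| + index i (enum I)).
  by rewrite /m; lia.
exists R => z; rewrite /ev hR nth_cat size_map -cardE ltnNge leq_addr /= addKn.
by rewrite (nth_map i) ?nth_index ?mem_enum // -cardE.
Qed.

Let rees_add g h : rees g -> rees h -> rees (fun z => g z + h z).
Proof. by move=> [R hR] [S hS]; exists (R + S) => z; rewrite rmorphD hR hS. Qed.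

Let rees_mul g h : rees g -> rees h -> rees (fun z => g z * h z).
Proof. by move=> [R hR] [S hS]; exists (R * S) => z; rewrite rmorphM hR hS. Qed.

Let rees_polyfun p : polyfun p -> rees (fun z => (p z)%:P).
Proof.
elim=> [c|i|p1 p2 _ h1 _ h2|p1 p2 _ h1 _ h2] //.
- rewrite (_ : (fun z => _) = fun z => (p1 z)%:P + (p2 z)%:P); first exact: rees_add.
  by apply/funext => z; rewrite polyCD.
- rewrite (_ : (fun z => _) = fun z => (p1 z)%:P * (p2 z)%:P); first exact: rees_mul.
  by apply/funext => z; rewrite polyCM.
Qed.

Let rees_homogeneous r L : homogeneous r L -> rees (fun z => L (z - z0) *: 'X^r).
Proof.
elim=> {r L} [r|c|i|r p q _ h1 _ h2|r r' p q _ h1 _ h2].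
- rewrite (_ : (fun z => _) = fun=> 0%:P) //.
  by apply/funext => z; rewrite scale0r.
- rewrite (_ : (fun z => _) = fun=> c%:P) //.
  by apply/funext => z; rewrite expr0 alg_polyC.
- rewrite (_ : (fun z => _) = fun z : V => (z i - z0 i) *: 'X) //.
  by apply/funext => z; rewrite !ffunE expr1.
- rewrite (_ : (fun z => _) = fun z => p (z - z0) *: 'X^r + q (z - z0) *: 'X^r); first exact: rees_add.
  by apply/funext => z; rewrite scalerDl.
- rewrite (_ : (fun z => _) = fun z => p (z - z0) *: 'X^r * (q (z - z0) *: 'X^r')); first exact: rees_mul.
  by apply/funext => z; rewrite -scalerAl -scalerAr scalerA exprD.
Qed.

Let rees_vanishing r Q : vanishing r Q -> rees (fun z => Q z *: 'X^r).
Proof.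
elim=> {r Q} [r c L pc hL|r p q _ h1 _ h2].
  rewrite (_ : (fun z => _) = fun z => (c z)%:P * (L (z - z0) *: 'X^r)).
    by apply: rees_mul; [exact: rees_polyfun | exact: rees_homogeneous].
  by apply/funext => z; rewrite mul_polyC scalerA.
rewrite (_ : (fun z => _) = fun z => p z *: 'X^r + q z *: 'X^r); first exact: rees_add.
by apply/funext => z; rewrite scalerDl.
Qed.

(** In the Rees algebra the coefficient of T^j lies in the j-th power of the maximal ideal. Only its
    vanishing at [z0] for j > 0 is recorded: it keeps the final multiplier nonzero at [z0]. *)
Let tame (g : V -> {poly F}) :=
  forall j, polyfun (fun z => (g z)`_j) /\ ((0 < j)%N -> (g z0)`_j = 0).

Let tame_const c : tame (fun=> c%:P).
Proof.
by move=> j; split; [exact: pf_const | rewrite coefC; case: j].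
Qed.

Let tame_add g h : tame g -> tame h -> tame (fun z => g z + h z).
Proof.
move=> tg th j; have [pg vg] := tg j; have [ph vh] := th j; split.
  rewrite (_ : (fun z => _) = fun z => (g z)`_j + (h z)`_j); first exact: pf_add.
  by apply/funext => z; rewrite coefD.
by move=> j0; rewrite coefD vg // vh // addr0.
Qed.

Let tame_mul g h : tame g -> tame h -> tame (fun z => g z * h z).
Proof.
move=> tg th j; split.
  rewrite (_ : (fun z => _) = fun z => \sum_(i < j.+1) (g z)`_i * (h z)`_(j - i)).
    by apply: polyfun_sum => i; apply: pf_mul; [have [] := tg i | have [] := th (j - i)%N].
  by apply/funext => z; rewrite coefM.
move=> j0; rewrite coefM big1 // => -[i /= hi] _.
have [i0|i0] := posnP i; last by rewrite (tg i).2 // mul0r.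
by rewrite (th (j - i)%N).2 ?mulr0 // i0 subn0.
Qed.

Let tame_gens i : tame (fun z => nth 0 (gens z) i).
Proof.
have t0 : tame (fun=> 0) by rewrite -(polyC0 F); exact: tame_const.
have [hi|hi] := ltnP i #|I|.
  pose x := enum_val (Ordinal hi).
  rewrite (_ : (fun z => _) = fun z : V => (z x)%:P).
    move=> j; split; last by rewrite coefC; case: j.
    rewrite (_ : (fun z => _) = fun z : V => if j == 0%N then z x else 0).
      by case: (j == 0%N); [exact: pf_coord | exact: pf_const].
    by apply/funext => z; rewrite coefC.
  apply/funext => z; rewrite nth_cat size_map -cardE hi.
  have ex : nth x (enum I) i = x by rewrite {2}/x (enum_val_nth x).
  by rewrite (nth_map x) -?cardE // ex.
have [hi2|hi2] := ltnP (i - #|I|) #|I|; last first.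
  rewrite (_ : (fun z => _) = fun=> 0) //; apply/funext => z.
  have sz : size (gens z) = (#|I| + #|I|)%N by rewrite size_cat size_map -cardE size_map -cardE.
  by rewrite nth_default // sz; lia.
pose x := enum_val (Ordinal hi2).
rewrite (_ : (fun z => _) = fun z : V => (z x - z0 x) *: 'X).
  move=> j; split; last by rewrite subrr scale0r coef0.
  rewrite (_ : (fun z => _) = fun z : V => (z x - z0 x) * 'X`_j).
    apply: pf_mul; last exact: pf_const.
    by apply: polyfun_sub; [exact: pf_coord | exact: pf_const].
  by apply/funext => z; rewrite coefZ.
apply/funext => z; rewrite nth_cat size_map -cardE ltnNge hi /=.
have ex : nth x (enum I) (i - #|I|) = x by rewrite {2}/x (enum_val_nth x).
by rewrite (nth_map x) -?cardE // ex.
Qed.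

Let tame_ev R : tame (fun z => ev z R).
Proof.
rewrite /ev; move: R.
pose E j z := iter_eval (polyC : {rmorphism F -> {poly F}}) (nth 0 (gens z)) j.
rewrite -/(E m _); elim: m => [c|j IH]; first exact (tame_const (c : F)).
elim/poly_ind => [|p c IHp].
  rewrite (_ : (fun z => _) = fun=> (0 : F)%:P); first exact (tame_const 0).
  by apply/funext => z; rewrite rmorph0.
rewrite (_ : (fun z => _) =
  fun z => E j.+1 z p * nth 0 (gens z) j + E j z c).
  exact: tame_add (tame_mul IHp (tame_gens j)) (IH c).
apply/funext => z; rewrite rmorphD rmorphM /E /= horner_morphX.
by rewrite horner_morphC.
Qed.

(* Krull's intersection theorem: in the Noetherian Rees algebra, h_n p T^n is a
   combination of the h_i p T^i with i < n, and taking the coefficient of T^n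
   gives p * (h_n - sum of functions vanishing at z0) = 0 on Z. *)
Lemma krull_intersection (Z : V -> Prop) p :
  (forall r, exists h Q, [/\ polyfun h, h z0 != 0, vanishing r Q &
     forall z, Z z -> h z * p z = Q z]) ->
  exists h, [/\ polyfun h, h z0 != 0 & forall z, Z z -> h z * p z = 0].
Proof.
move=> /(_ _)/cid-/all_sig[h] /(_ _)/cid-/all_sig[Q] H.
have /(_ _)/cid-/all_sig[R hR] : forall r, rees (fun z => Q r z *: 'X^r).
  by move=> r; apply: rees_vanishing; have [] := H r.
have [n [c ec]] := noetherian_seq R (@iter_poly_noetherian F m).
pose k z := h n z - \sum_(i < n) h i z * (ev z (c i))`_(n - i).
exists k; split.
- apply: polyfun_sub; first by have [] := H n.
  apply: polyfun_sum => i; apply: pf_mul; first by have [] := H i.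
  by have [] := tame_ev (c i) (n - i)%N.
- rewrite /k big1 ?subr0; first by have [] := H n.
  move=> i _; have [_ ->] := tame_ev (c i) (n - i)%N; rewrite ?mulr0 //.
  by rewrite subn_gt0.
- move=> z Zz; have e := congr1 (fun x => (ev z x)`_n) ec.
  move: e; rewrite /= rmorph_sum -hR coefZ coefXn eqxx mulr1.
  have [_ _ _ /(_ z Zz) <-] := H n.
  rewrite coef_sum => e; rewrite /k mulrBl e mulr_suml -sumrB big1 // => i _.
  rewrite rmorphM -hR -scalerAr coefZ coefMXn ltnNge ltnW //=.
  have [_ _ _ /(_ z Zz) <-] := H i; ring.
Qed.

End Rees.
End OrderOfVanishing.

Lemma poly_eq0_horner (F : numDomainType) (P : {poly F}) :
  (forall t, P.[t] = 0) -> P = 0.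
Proof.
move=> P0; apply/eqP; apply: contraT => nz.
have := @max_poly_roots _ P [seq i%:R | i <- iota 0 (size P)] nz.
rewrite size_map size_iota ltnn => -> //.
  by apply/allP => x _; apply/eqP.
by rewrite map_inj_uniq ?iota_uniq // => i j /eqP; rewrite eqr_nat => /eqP.
Qed.

(** * A tangent space criterion for irreducible components *)

Section ComponentCriterion.
Variables (F : numFieldType) (I : finType).
Notation V := {ffun I -> F}.
(* The type of coordinates [F] carries no [F]-module structure; [F^o] does. *)
Notation W := {ffun I -> F^o}.
Implicit Types (p q L Q : V -> F).

Definition curve_in (G : V -> Prop) (g : I -> {poly F}) :=
  forall t, G [ffun i => (g i).[t]].

(** Suppose neither closed set contains the closure: some equation [p] of the first is nonzero at a
    point a of [G], and some [q] of the second at a point b. On a curve in [G] joining a to b the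
    product of their restrictions vanishes identically, so one of the two restrictions is zero. *)
Lemma zirreducible_zclosure (G : V -> Prop) :
  (exists x, G x) ->
  (forall a b, G a -> G b -> exists g, [/\ curve_in G g,
      [ffun i => (g i).[0]] = a & [ffun i => (g i).[1]] = b]) ->
  zirreducible (zclosure G).
Proof.
move=> [x0 Gx0] conn; split.
  by exists x0 => p _; apply.
move=> F1 F2 [P1 [pP1 e1]] [P2 [pP2 e2]] cov.
apply: contrapT => /not_orP[/existsNP[x /not_implyP[Xx nx]] /existsNP[y /not_implyP[Xy ny]]].
have {nx}/existsNP[p /not_implyP[Pp px]] : ~ (forall p, P1 p -> p x = 0) by move=> /e1.
have {ny}/existsNP[q /not_implyP[Pq qy]] : ~ (forall p, P2 p -> p y = 0) by move=> /e2.
have pp := pP1 _ Pp; have pq := pP2 _ Pq.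
have [a Ga pa] : exists2 a, G a & p a <> 0.
  apply: contrapT => N; apply: px; apply: Xx => // a Ga.
  by apply: contrapT => pa; apply: N; exists a.
have [b Gb qb] : exists2 b, G b & q b <> 0.
  apply: contrapT => N; apply: qy; apply: Xy => // b Gb.
  by apply: contrapT => pb; apply: N; exists b.
have [g [Gg ga gb]] := conn a b Ga Gb.
have [P hP] := polyfun_curve g pp; have [Q hQ] := polyfun_curve g pq.
have /eqP : P * Q = 0.
  apply: poly_eq0_horner => t; rewrite hornerM -hP -hQ.
  have [|/e1/(_ _ Pp) ->|/e2/(_ _ Pq) ->] := cov [ffun i => (g i).[t]]; rewrite ?mul0r ?mulr0 //.
  by move=> r _; apply; apply: Gg.
rewrite mulf_eq0 => /orP[] /eqP e0.
  by apply: pa; rewrite -ga hP e0 horner0.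
by apply: qb; rewrite -gb hQ e0 horner0.
Qed.

Lemma homogeneous_sum r (J : Type) (s : seq J) (f : J -> V -> F) :
  (forall j, homogeneous r (f j)) -> homogeneous r (fun x => \sum_(j <- s) f j x).
Proof.
move=> pf; elim: s => [|j s IH].
  rewrite (_ : (fun x => _) = (fun=> 0)); first exact: homog_zero.
  by apply/funext => x; rewrite big_nil.
rewrite (_ : (fun x => _) = (fun x => f j x + \sum_(j <- s) f j x)).
  exact: homog_add.
by apply/funext => x; rewrite big_cons.
Qed.

Lemma homogeneous_comp r L (pi : {linear W -> W}) :
  homogeneous r L -> homogeneous r (fun v => L (pi v)).
Proof.
elim=> {r L} [r|c|i|r p q _ h1 _ h2|r r' p q _ h1 _ h2].
- exact: homog_zero.
- exact: homog_const.
- pose e j : W := [ffun k => (k == j)%:R].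
  have ev (v : W) : v = \sum_j v j *: e j.
    apply/ffunP => k; rewrite sum_ffunE (bigD1 k) //= !ffunE eqxx [_ *: _]mulr1 big1 ?addr0 //.
    by move=> j jk; rewrite !ffunE eq_sym (negPf jk) [_ *: _]mulr0.
  rewrite (_ : (fun v : V => _) = fun v : V => \sum_j v j * (pi (e j) : V) i).
    by apply: homogeneous_sum => j;
      exact (homog_mul (@homog_coord F I j) (@homog_const F I ((pi (e j) : V) i))).
  apply/funext => v; rewrite [in LHS](ev v) linear_sum sum_ffunE.
  by apply: eq_bigr => j _; rewrite linearZ ffunE.
- exact: homog_add.
- exact: homog_mul.
Qed.

Variables (G Z : V -> Prop) (z0 : V) (d : V -> F) (a b : nat).
Variable f : {linear W -> 'M[F]_(a, b)}.
Hypotheses (pd : polyfun d) (d0 : d z0 != 0).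
(** [fZ] says that on [Z] the entries of [f] have order two up to the unit [d], so the Zariski
    tangent space of [Z] at [z0] lies in the kernel of [f]. The next hypothesis realises every
    vector of this kernel by a curve in [G], so the tangent spaces coincide. *)
Hypothesis fZ : forall i j, exists2 Q, vanishing z0 2 Q &
   forall z, Z z -> d z * f (z - z0) i j = Q z.
Hypothesis fT : forall w, f w = 0 ->
   exists g : I -> {poly F}, [/\ curve_in G g, forall i, (g i)`_0 = z0 i &
      forall i, (g i)`_1 = w i].
Hypothesis GZ : forall z, G z -> Z z.

Let good r u := exists2 Q, vanishing z0 r.+1 Q &
  forall z, Z z -> d z * u (z - z0) = Q z.

(** [good r u] is meant for a form [u] of degree [r]: on [Z], up to the unit [d], it has one order
    more than expected. *)
Let good_add r u w : good r u -> good r w -> good r (fun v => u v + w v).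
Proof.
move=> [Q vQ hQ] [R vR hR]; exists (fun z => Q z + R z); first exact: vanishing_add.
by move=> z Zz; rewrite mulrDr hQ ?hR.
Qed.

Let good_mul r r' u L : good r u -> homogeneous r' L -> good (r + r') (fun v => u v * L v).
Proof.
move=> [Q vQ hQ] hL; exists (fun z => Q z * L (z - z0)).
  by rewrite -addSn; exact: vanishing_mul vQ (vanishing_of_homogeneous z0 hL).
by move=> z Zz; rewrite mulrA hQ.
Qed.

Let good0 r : good r (fun=> 0).
Proof. by exists (fun=> 0) => [|z _]; [exact: vanishing_0 | rewrite mulr0]. Qed.

Let lf := linfun f.
(** A projection onto the kernel of [f], obtained from a generalised inverse. *)
Let pi : 'End(W) := (\1 - (lf^-1 \o lf))%VF.

Let pi_ker (v : W) : f (pi v) = 0.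
Proof.
have e (x : V) : f x = lf x by rewrite lfunE.
rewrite e /pi add_lfunE id_lfunE opp_lfunE comp_lfunE linearB /= limg_lfunVK ?subrr //.
exact: memv_img (memvf _).
Qed.

(** The difference [v - pi v] is the image of [f v] under a linear map, so for coordinates this is
    [fZ]. Products are telescoped, replacing [v] by [pi v] in one factor at a time. *)
Let good_sub_pi r L : homogeneous r L -> good r (fun v => L v - L (pi v)).
Proof.
elim=> {r L} [r|c|i|r p0 q0 _ h1 _ h2|r r' p q hp h1 hq h2].
- by rewrite (_ : (fun v => _) = fun=> 0); [exact: good0 | apply/funext => v; rewrite subrr].
- by rewrite (_ : (fun v => _) = fun=> 0); [exact: good0 | apply/funext => v; rewrite subrr].
- have /(_ _)/cid-/all_sig[Q] : forall ij : 'I_a * 'I_b, exists Q, vanishing z0 2 Q /\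
     forall z, Z z -> d z * f (z - z0) ij.1 ij.2 = Q z.
    by move=> [i' j']; have [Q ? ?] := fZ i' j'; exists Q.
  move=> HQ.
  exists (fun z => \sum_ij (lf^-1%VF (delta_mx ij.1 ij.2)) i * Q ij z).
    apply: vanishing_sum => ij; apply: vanishing_mull; first exact: pf_const.
    by have [] := HQ ij.
  move=> z Zz; set v := z - z0.
  rewrite (_ : v i - pi v i = lf^-1%VF (f v) i); last first.
    by rewrite /pi add_lfunE id_lfunE opp_lfunE comp_lfunE !ffunE lfunE opprD opprK addrA subrr add0r.
  rewrite (matrix_sum_delta (f v)) pair_big /= linear_sum sum_ffunE mulr_sumr.
  apply: eq_bigr => ij _; have [_ <-] := HQ ij; last by [].
  by rewrite linearZ ffunE /= /GRing.scale /= mulrA mulrC.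
- rewrite (_ : (fun v => _) = fun v => (p0 v - p0 (pi v)) + (q0 v - q0 (pi v))).
    exact: good_add.
  by apply/funext => v; ring.
- rewrite (_ : (fun v => _) =
    fun v => (p v - p (pi v)) * q v + (q v - q (pi v)) * p (pi v)).
    apply: good_add; first exact: good_mul.
    by rewrite addnC; apply: good_mul => //; exact: homogeneous_comp.
  by apply/funext => v; ring.
Qed.

(* On Z, modulo the r.+1-st power of the ideal of z0, the leading form L of h p
   only depends on the tangent directions pi v, where it vanishes because p
   vanishes on curves in G; so h p is in every power of the ideal, up to units. *)
Lemma vanish_near p : polyfun p -> (forall z, G z -> p z = 0) ->
  exists h, [/\ polyfun h, h z0 != 0 & forall z, Z z -> h z * p z = 0].
Proof.
move=> pp pG; apply: (krull_intersection (Z := Z)).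
elim=> [|r [h [Q [ph h0 vQ hQ]]]].
  exists (fun=> 1), p; split; [exact: pf_const | exact: oner_neq0 | exact: polyfun_vanishing0 |].
  by move=> z _; rewrite mul1r.
have [L hL vL] := vanishing_leading_form vQ.
have Lpi v : L (pi v) = 0.
  have [g [Gg g0 g1]] := fT (pi_ker v).
  have [P1 h1 e1] := homogeneous_curve g0 hL.
  have [P2 h2] := vanishing_curve g0 vL.
  have e : 'X^r * (P1 + 'X * P2) = 0.
    apply: poly_eq0_horner => t.
    rewrite hornerM hornerXn hornerD hornerM hornerX mulrDr mulrA -exprSr -h1 -h2.
    rewrite addrC subrK -hQ; last exact: GZ.
    by rewrite (pG _ (Gg t)) mulr0.
  move/eqP: e; rewrite mulf_eq0 expf_eq0 polyX_eq0 andbF /= => /eqP /(congr1 (horner^~ 0)).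
  rewrite /= hornerD hornerM hornerX mul0r addr0 horner0 e1 => <-.
  by congr L; apply/ffunP => i; rewrite ffunE g1.
have [Q' vQ' hQ'] := good_sub_pi hL.
exists (fun z => d z * h z), (fun z => d z * (Q z - L (z - z0)) + Q' z); split.
- exact: pf_mul.
- by rewrite mulf_neq0.
- by apply: vanishing_add => //; exact: vanishing_mull.
- move=> z Zz; rewrite -hQ' // Lpi subr0 -mulrA hQ //; ring.
Qed.

Theorem component_criterion :
  zclosed Z -> G z0 -> zirreducible (zclosure G) ->
  irreducible_component (zclosure G) Z.
Proof.
move=> [P [pP eP]] Gz0 irr; split=> //.
  move=> x Xx; apply/eP => p Pp; apply: Xx; first exact: pP.
  by move=> y /GZ /eP; apply.
move=> Y [_ irrY] XY YZ y Yy p pp pG.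
have [h [ph h0 hp]] := vanish_near pp pG.
have zc q : polyfun q -> zclosed (fun x => q x = 0).
  move=> pq; exists (eq q); split=> [r <- //|x].
  by split=> [q0 r <- //|]; apply.
(* Since [h * p] vanishes on [Y], irreducibility puts [Y] in the zeros of [h] or in those of [p];
   the former is excluded by [z0]. *)
have [x Yx||] := irrY _ _ (zc _ ph) (zc _ pp).
- by have /eqP := hp x (YZ _ Yx); rewrite mulf_eq0 => /orP[]/eqP; [left | right].
- by move=> /(_ z0) e; case/eqP: h0; apply: e; apply: XY => q _; apply.
- exact.
Qed.

End ComponentCriterion.

(** * Flattenings and minors *)

Section RankMinors.
Variable F : fieldType.

(** If the rank were at least [r], then [r] rows of a maximal free family, followed by [r] columns
    spanning the column space of these rows, would give an invertible minor. Both selections are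
    injective, as the hypothesis demands. *)
Lemma rank_minors m n r (A : 'M[F]_(m, n)) :
  (forall (f : 'I_r -> 'I_m) (g : 'I_r -> 'I_n), injective f -> injective g ->
     \det (mxsub f g A) = 0) -> (\rank A < r)%N.
Proof.
move=> H; rewrite ltnNge; apply/negP => rA.
pose w := widen_ord rA.
have winj : injective w by move=> i j /(congr1 val) /= ?; apply: val_inj.
pose B := rowsub (maxrankfun A \o w) A.
have Bfree : row_free B.
  rewrite /B rowsub_comp rowsubE /row_free mxrankMfree; last exact: maxrowsub_free.
  apply/row_freeP; exists (colsub w 1%:M); rewrite mulmx_colsub mulmx1.
  by apply/matrixP => i j; rewrite !mxE (inj_eq winj).
have BTfull : row_full B^T by rewrite /row_full mxrank_tr.
have := fullrowsub_unit BTfull; rewrite unitmxE unitfE -det_tr trmx_mxsub trmxK.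
rewrite /B -mxsub_comp => /eqP; apply; apply: H.
  by move=> i j /= /(@maxrankfun_inj _ _ _ A) /winj.
by move=> i j /= /(@fullrankfun_inj _ _ _ _ BTfull).
Qed.

Lemma det_mxsub_rank m n r (A : 'M[F]_(m, n)) (f : 'I_r -> 'I_m) (g : 'I_r -> 'I_n) :
  (\rank A < r)%N -> \det (mxsub f g A) = 0.
Proof.
move=> rA; apply/eqP; rewrite -[_ == 0]negbK -unitfE -unitmxE -row_free_unit /row_free.
rewrite ltn_eqF // (leq_ltn_trans _ rA) //.
have -> : mxsub f g A = rowsub f 1%:M *m A *m colsub g 1%:M.
  by rewrite mulmx_colsub mulmx1 mul_rowsub_mx mul1mx mxsubcr.
by rewrite (leq_trans (mxrankM_maxl _ _)) // mxrankM_maxr.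
Qed.

(* The Schur complement of an invertible minor of maximal size vanishes. *)
Lemma bordered_minor m n r (A : 'M[F]_(m, n)) (P : 'M_(r, m)) (Q : 'M_(n, r))
    (a : 'rV_m) (b : 'cV_n) : (\rank A <= r)%N ->
  let D := P *m A *m Q in
  \det D ^+ 2 *: (a *m A *m b) =
  \det D *: ((a *m A *m Q) *m \adj D *m (P *m A *m b)).
Proof.
move=> rA D; have [uD|] := boolP (D \in unitmx); last first.
  by rewrite unitmxE unitfE negbK => /eqP ->; rewrite expr0n /= !scale0r.
have rPA : (A <= P *m A)%MS.
  rewrite -(geq_leqif (mxrank_leqif_sup (submxMl P A))).
  rewrite (leq_trans rA) //.
  have : \rank D = r by apply/eqP; rewrite -[_ == _]/(row_free D) row_free_unit.
  by move=> {1}<-; rewrite mxrankM_maxl.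
have /submxP[Y eY] := rPA.
have e : a *m A *m b = a *m A *m Q *m invmx D *m (P *m A *m b).
  move: uD eY; rewrite /D; move: (P *m A) => W uW ->.
  by rewrite !mulmxA -(mulmxA _ W Q) mulmxK.
rewrite e /invmx uD -!scalemxAr -!scalemxAl scalerA expr2 mulfK //.
by rewrite -unitfE -unitmxE.
Qed.

End RankMinors.

Section Flattening.
Variables (F : numFieldType) (n k s : nat).
Notation V := (wedge F n k).

Definition flatmx (z : V) : 'M[F]_(#|{: ksub n s}|, #|{: ksub n (k - s)}|) :=
  \matrix_(i, j) skewflat z (enum_val i) (enum_val j).

Lemma minors_zeroP r z : @minors_zero F n k s r z <-> (\rank (flatmx z) < r)%N.
Proof.
split=> [H|H f g _ _].
  apply: rank_minors => f g fi gi.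
  rewrite (_ : mxsub f g _ = \matrix_(i, j) skewflat z (enum_val (f i)) (enum_val (g j))).
    by apply: H; apply: inj_comp => //; exact: enum_val_inj.
  by apply/matrixP => i j; rewrite !mxE.
rewrite -(det_mxsub_rank (enum_rank \o f) (enum_rank \o g) H).
by congr (\det _); apply/matrixP => i j; rewrite !mxE /= !enum_rankK.
Qed.

Lemma wcoord_linear (c : F) (z1 z2 : V) (A : {set 'I_n}) :
  wcoord [ffun S => c * z1 S + z2 S] A = c * wcoord z1 A + wcoord z2 A.
Proof. by rewrite /wcoord; case: insubP => [u _ _|_]; rewrite ?ffunE ?mulr0 ?addr0. Qed.

Lemma skewflat_linear (c : F) (z1 z2 : V) (A : ksub n s) (B : ksub n (k - s)) :
  skewflat [ffun S => c * z1 S + z2 S] A B = c * skewflat z1 A B + skewflat z2 A B.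
Proof.
rewrite /skewflat; case: ifP => _; rewrite ?mulr0 ?addr0 // wcoord_linear.
by rewrite mulrDr mulrCA.
Qed.

Lemma polyfun_skewflat A B : polyfun (fun z : V => @skewflat F n k s z A B).
Proof.
rewrite /skewflat; case: [disjoint val A & val B]; last exact: pf_const.
apply: pf_mul; first exact: pf_const.
by rewrite /wcoord; case: (insub _) => [u|]; [exact: pf_coord | exact: pf_const].
Qed.

Lemma polyfun_mulmx (I : finType) m1 m2 m3 (A : {ffun I -> F} -> 'M[F]_(m1, m2))
   (B : {ffun I -> F} -> 'M[F]_(m2, m3)) :
  (forall i j, polyfun (fun z => A z i j)) -> (forall i j, polyfun (fun z => B z i j)) ->
  forall i j, polyfun (fun z => (A z *m B z) i j).
Proof.
move=> pA pB i j; rewrite (_ : (fun z => _) = fun z => \sum_l A z i l * B z l j).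
  by apply: polyfun_sum => l; apply: pf_mul.
by apply/funext => z; rewrite mxE.
Qed.

Lemma polyfun_adj (I : finType) m (A : {ffun I -> F} -> 'M[F]_m) :
  (forall i j, polyfun (fun z => A z i j)) ->
  forall i j, polyfun (fun z => (\adj (A z)) i j).
Proof.
move=> pA i j; rewrite (_ : (fun z => _) = fun z => cofactor (A z) j i).
  apply: pf_mul; first exact: pf_const.
  apply: polyfun_det => i' j'.
  by rewrite (_ : (fun z => _) = fun z => A z (lift j i') (lift i j')) //;
    apply/funext => z; rewrite !mxE.
by apply/funext => z; rewrite mxE.
Qed.

Lemma polyfun_flatmx i j : polyfun (fun z : V => flatmx z i j).
Proof.
rewrite (_ : (fun z => _) = fun z : V => skewflat z (enum_val i) (enum_val j)).
  exact: polyfun_skewflat.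
by apply/funext => z; rewrite mxE.
Qed.

Lemma zclosed_minors_zero r : zclosed (@minors_zero F n k s r).
Proof.
exists (fun p => exists (f : 'I_r -> ksub n s) (g : 'I_r -> ksub n (k - s)),
  [/\ injective f, injective g & p = flat_minor f g]); split.
  move=> _ [f [g [_ _ ->]]]; apply: polyfun_det => i j.
  rewrite (_ : (fun z => _) = fun z : V => skewflat z (f i) (g j)).
    exact: polyfun_skewflat.
  by apply/funext => z; rewrite mxE.
move=> z; split=> [H _ [f [g [fi gi ->]]]|H f g fi gi]; first exact: H.
by apply: H; exists f, g.
Qed.

Variables (G : V -> Prop) (z0 : V) (r : nat).
(** Arbitrary compressions instead of selections of [r] rows and columns: the nonvanishing is then
    checked after row and column operations. *)
Variables (P : 'M[F]_(r, #|{: ksub n s}|)) (Q : 'M[F]_(#|{: ksub n (k - s)}|, r)).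
Hypothesis dPQ : \det (P *m flatmx z0 *m Q) != 0.
Hypothesis tangent : forall w : V,
  (forall (a : 'rV_#|{: ksub n s}|) (b : 'cV_#|{: ksub n (k - s)}|),
     a *m flatmx z0 = 0 -> flatmx z0 *m b = 0 -> a *m flatmx w *m b = 0) ->
  exists g, [/\ curve_in G g, forall i, (g i)`_0 = z0 i & forall i, (g i)`_1 = w i].
Hypothesis GZ : forall z, G z -> @minors_zero F n k s r.+1 z.

(** The rows of [Ka] and the columns of [Kb] span the left and right kernels, so [f v] collects the
    pairings of [v] with all products of kernel vectors. *)
Let Ka := kermx (flatmx z0).
Let Kb := (kermx (flatmx z0)^T)^T.
Let f (v : {ffun ksub n k -> F^o}) := Ka *m flatmx (v : V) *m Kb.

Let f_linear : linear f.
Proof.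
move=> c u v; rewrite /f scalemxAl scalemxAr -mulmxDl -mulmxDr; congr (_ *m _ *m _).
apply/matrixP => i j; rewrite !mxE -skewflat_linear; congr skewflat.
by apply/ffunP => S; rewrite !ffunE.
Qed.

HB.instance Definition _ :=
  GRing.isLinear.Build F {ffun ksub n k -> F^o}
    'M[F]_(#|{: ksub n s}|, #|{: ksub n (k - s)}|) _ f f_linear.

(** By [bordered_minor], on the zero set [\det (D z) ^+ 2] times an entry of [f z] is a combination
    of products of two factors: a kernel row times the flattening, and the flattening times a kernel
    column. Each factor vanishes at [z0], whence order two. *)
Lemma flattening_component : G z0 -> zirreducible (zclosure G) ->
  irreducible_component (zclosure G) (@minors_zero F n k s r.+1).
Proof.
pose D z := P *m flatmx z *m Q.
have pD i j : polyfun (fun z => D z i j).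
  apply: polyfun_mulmx => [|? ?]; last exact: pf_const.
  by apply: polyfun_mulmx => [? ?|]; [exact: pf_const | exact: polyfun_flatmx].
have van1 p : polyfun p -> p z0 = 0 -> vanishing z0 1 p.
  move=> pp p0; have := vanishing_sub_value z0 pp.
  by rewrite p0; congr vanishing; apply/funext => z; rewrite subr0.
have Kb0 : flatmx z0 *m Kb = 0.
  by rewrite -[flatmx z0]trmxK /Kb -trmx_mul mulmx_ker trmx0.
move=> Gz0 irr.
apply: (@component_criterion F _ G _ z0 (fun z => \det (D z) ^+ 2) _ _ f) => //.
- rewrite (_ : (fun z => _) = fun z => \det (D z) * \det (D z)) //.
  by apply: pf_mul; exact: polyfun_det.
- by rewrite expf_neq0.
- move=> i j.
  exists (fun z => \det (D z) * (((row i Ka *m flatmx z *m Q) *m \adj (D z)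
       *m (P *m flatmx z *m col j Kb)) 0 0)).
    apply: vanishing_mull; first exact: polyfun_det.
    rewrite (_ : (fun z => _) = fun z =>
      \sum_l ((\sum_m (row i Ka *m flatmx z *m Q) 0 m * (\adj (D z)) m l))
        * (P *m flatmx z *m col j Kb) l 0); last first.
      apply/funext => z; rewrite mxE; apply: eq_bigr => l _; congr (_ * _).
      by rewrite mxE.
    apply: vanishing_sum => l; apply: (@vanishing_mul F _ z0 1 1); last first.
      apply: van1; last by rewrite colE -mulmxA (mulmxA (flatmx z0)) Kb0 mul0mx mulmx0 mxE.
      apply: polyfun_mulmx => [|? ?]; last exact: pf_const.
      by apply: polyfun_mulmx => [? ?|]; [exact: pf_const | exact: polyfun_flatmx].
    apply: vanishing_sum => m.
    apply: (@vanishing_mul F _ z0 1 0); last first.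
      by apply: polyfun_vanishing0; exact: polyfun_adj.
    apply: van1; last by rewrite -row_mul mulmx_ker row0 mul0mx mxE.
    apply: polyfun_mulmx => [|? ?]; last exact: pf_const.
    by apply: polyfun_mulmx => [? ?|]; [exact: pf_const | exact: polyfun_flatmx].
  move=> z /minors_zeroP rz.
  have f0 : f z0 = 0 by rewrite /f mulmx_ker mul0mx.
  have fB : f (z - z0) = f z.
    by rewrite -[RHS]subr0 -f0; exact: (linearB (f : {linear _ -> _})).
  transitivity (\det (D z) ^+ 2 * f z i j).
    by congr (_ * fun_of_matrix _ i j); exact: fB.
  have := bordered_minor P Q (row i Ka) (col j Kb) rz.
  move/(congr1 (fun A : 'M_1 => A 0 0)); rewrite mxE [X in _ = X -> _]mxE => <-.
  congr (_ * _); rewrite /f [col j Kb]colE mulmxA -colE -!row_mul.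
  by rewrite [RHS]mxE [RHS]mxE.
- move=> w fw; apply: tangent => a b /sub_kermxP/submxP[u ->] b0.
  have /sub_kermxP/submxP[v ev] : b^T *m (flatmx z0)^T = 0 by rewrite -trmx_mul b0 trmx0.
  have -> : b = Kb *m v^T by rewrite -[b]trmxK ev trmx_mul.
  by rewrite mulmxA -2!(mulmxA u) [Ka *m _ *m _]fw mulmx0 mul0mx.
- exact: zclosed_minors_zero.
Qed.

End Flattening.

(** * Plucker coordinates *)

Definition mk_ksub n k (S : {set 'I_n}) (h : #|S| == k) : ksub n k :=
  exist (fun S : {set 'I_n} => #|S| == k) S h.

Section Sorting.
Variables (n k : nat).

Lemma ksub_elt_mono (X : ksub n k) (i j : 'I_k) : (i < j)%N -> (ksub_elt X i < ksub_elt X j)%N.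
Proof.
move=> ij; have x0 := ksub_elt X i.
rewrite /ksub_elt !(enum_val_nth x0) /=.
have srt : sorted (fun a b : 'I_n => (a < b)%N) (enum (mem (val X))).
  rewrite {1}/enum_mem; apply: sorted_filter; first by move=> ? ? ?; apply: ltn_trans.
  by have := iota_ltn_sorted 0 n; rewrite -val_enum_ord sorted_map -enumT.
apply: (sorted_ltn_nth _ _ srt) => //; first by move=> ? ? ?; apply: ltn_trans.
  by rewrite inE -cardE (eqP (valP X)).
by rewrite inE -cardE (eqP (valP X)).
Qed.

Lemma ksub_elt_in (X : ksub n k) i : ksub_elt X i \in val X.
Proof. exact: enum_valP. Qed.

Lemma ksub_elt_inj (X : ksub n k) : injective (ksub_elt X).
Proof. by move=> i j /enum_val_inj /cast_ord_inj. Qed.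

Lemma ksub_elt_surj (X : ksub n k) x : x \in val X -> exists i, ksub_elt X i = x.
Proof.
move=> xX; exists (cast_ord (eqP (valP X)) (enum_rank_in xX x)).
by rewrite /ksub_elt cast_ordK enum_rankK_in.
Qed.

Definition inversions (x : 'I_k -> 'I_n) : nat :=
  (\sum_(i < k) \sum_(j < k | (i < j)%N) (x j < x i)%N)%N.

Lemma det_colsub_sort (R : comNzRingType) (x : 'I_k -> 'I_n) (X : ksub n k)
    (M : 'M[R]_(k, n)) : injective x -> (forall i, x i \in val X) ->
  \det (colsub x M) = (-1) ^+ inversions x * \det (colsub (ksub_elt X) M).
Proof.
(* The sign of the sorting permutation is read off from Vandermonde determinants. *)
move=> xinj xX.
have ex i : exists l, ksub_elt X l == x i.
  by have [l <-] := ksub_elt_surj (xX i); exists l.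
pose f i := xchoose (ex i).
have fE i : ksub_elt X (f i) = x i by apply/eqP; exact: (xchooseP (ex i)).
have finj : injective f by move=> i j /(congr1 (ksub_elt X)); rewrite !fE => /xinj.
pose s := perm finj.
have detE (R' : comNzRingType) m (N : 'M[R']_(k, m)) (u : 'I_k -> 'I_m) :
    \det (colsub (u \o f) N) = (-1) ^+ s * \det (colsub u N).
  have eu : u \o f =1 u \o s by move=> i; rewrite /= permE.
  rewrite (eq_colsub _ eu).
  by rewrite colsub_comp -col_permEsub col_permE det_mulmx det_perm odd_permV mulrC.
have ex' : x =1 ksub_elt X \o f by move=> i; rewrite /= fE.
rewrite (eq_colsub _ ex').
rewrite detE; congr (_ * _).
rewrite -[RHS]signr_odd; congr (_ ^+ nat_of_bool _).
pose V (u : 'I_k -> nat) : 'M[int]_k := Vandermonde k (\row_i (u i)%:Z).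
have VE u : V (u \o f) = colsub f (V u) by apply/matrixP => i j; rewrite !mxE.
have sgV u : Num.sg (\det (V u)) =
    \prod_(i < k) \prod_(j < k | (i < j)%N) Num.sg ((u j)%:Z - (u i)%:Z).
  rewrite /V det_Vandermonde (big_morph Num.sg (@sgrM _) (@sgr1 _)).
  apply: eq_bigr => i _; rewrite (big_morph Num.sg (@sgrM _) (@sgr1 _)).
  by apply: eq_bigr => j _; rewrite !mxE.
have := detE _ _ (V (fun i => ksub_elt X i)) id.
rewrite (_ : colsub (id \o f) _ = V (fun i => x i)); last first.
  by apply/matrixP => i j; rewrite !mxE /= fE.
rewrite (_ : colsub id _ = V (fun i => ksub_elt X i)); last first.
  by apply/matrixP => i j; rewrite !mxE.
move/(congr1 Num.sg); rewrite sgrM !sgV [X in _ = _ * X]big1 ?mulr1; last first.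
  move=> i _; rewrite big1 // => j ij; apply: gtr0_sg.
  by rewrite subr_gt0 ltz_nat ksub_elt_mono.
rewrite (_ : \prod_i _ = (-1) ^+ inversions x); last first.
  rewrite /inversions expr_sum; apply: eq_bigr => i _; rewrite expr_sum.
  apply: eq_bigr => j ij; have [xji|xij] := ltnP (x j) (x i).
    by rewrite expr1 ltr0_sg // subr_lt0 ltz_nat.
  rewrite expr0 gtr0_sg // subr_gt0 ltz_nat ltn_neqAle xij andbT.
  by apply: contraTneq ij => /val_inj/xinj ->; rewrite ltnn.
rewrite sgrX sgrN1 => e.
have /(@signr_inj int) -> : (-1) ^+ odd (inversions x) = (-1) ^+ odd_perm s :> int.
  by rewrite signr_odd.
by [].
Qed.

End Sorting.

(** * Plücker coordinates along a line of matrices *)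

Section Lines.
Variables (F : fieldType) (n k : nat).
Implicit Types (M N : 'M[F]_(k, n)).

Definition plucker_line M N (X : ksub n k) : {poly F} :=
  \det (colsub (ksub_elt X) (map_mx polyC M + 'X *: map_mx polyC N)).

Lemma plucker_lineE M N X t : (plucker_line M N X).[t] = plucker (M + t *: N) X.
Proof.
rewrite /plucker_line -/(horner_eval t _) -det_map_mx ffunE; congr (\det _).
by apply/matrixP => i j; rewrite !mxE /= /horner_eval hornerD hornerM hornerX !hornerC.
Qed.

Lemma plucker_line_coef0 M N X : (plucker_line M N X)`_0 = plucker M X.
Proof. by rewrite -horner_coef0 plucker_lineE scale0r addr0. Qed.

Definition subst_row M N (i : 'I_k) : 'M[F]_(k, n) :=
  \matrix_(a, j) if a == i then N a j else M a j.

Lemma coef1_prod (I : eqType) (s : seq I) (a b : I -> F) : uniq s ->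
  (\prod_(i <- s) ((a i)%:P + b i *: 'X))`_1 =
  \sum_(i <- s) b i * \prod_(j <- s | j != i) a j.
Proof.
have c0 (r : seq I) : (\prod_(i <- r) ((a i)%:P + b i *: 'X))`_0 = \prod_(i <- r) a i.
  by rewrite coef0_prod; apply: eq_bigr => i _; rewrite coefD coefC coefZ coefX mulr0 addr0.
elim: s => [|x s IH] /=; first by rewrite !big_nil coef1.
case/andP=> xs us; rewrite !big_cons coefM !big_ord_recl big_ord0 /= subn0 IH // c0.
rewrite !coefD !coefC !coefZ !coefX eqxx /= mulr0 mulr1 !addr0 add0r addrC.
congr (_ * _ + _).
  rewrite big_seq [RHS]big_seq_cond; apply: eq_bigl => j.
  by case: (boolP (j \in s)) => //= js; apply/esym; apply: contraNneq xs => <-.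
rewrite mulr_sumr [LHS]big_seq [RHS]big_seq; apply: eq_bigr => i si.
rewrite big_cons ifT; last by apply: contraNneq xs => ->.
by rewrite mulrCA.
Qed.

Lemma plucker_line_coef1 M N X :
  (plucker_line M N X)`_1 = \sum_i plucker (subst_row M N i) X.
Proof.
rewrite /plucker_line /determinant coef_sum.
under [RHS]eq_bigr do rewrite ffunE /determinant.
rewrite exchange_big /=; apply: eq_bigr => s _.
rewrite -mulr_sumr -[X in _ = X * _](coefC _ 0).
rewrite (_ : (-1) ^+ s = ((-1) ^+ s)%:P :> {poly F}); last by rewrite rmorphXn rmorphN1.
rewrite coefCM coefC /=; congr (_ * _).
rewrite (eq_bigr (fun i => (M i (ksub_elt X (s i)))%:P + N i (ksub_elt X (s i)) *: 'X)).
  rewrite coef1_prod ?index_enum_uniq //; apply: eq_bigr => i _.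
  rewrite [RHS](bigD1 i) //= !mxE eqxx; congr (_ * _).
  by apply: eq_bigr => j ji; rewrite !mxE (negPf ji).
by move=> i _; rewrite !mxE mulrC mul_polyC.
Qed.

End Lines.

(** * Rank of the flattening of a decomposable vector *)

Section RankBound.
Variables (F : fieldType) (n : nat).

Lemma det_colsub_noninj (R : comNzRingType) k m (x : 'I_k -> 'I_m) (M : 'M[R]_(k, m)) i j :
  i != j -> x i = x j -> \det (colsub x M) = 0.
Proof.
by move=> ij e; rewrite -det_tr; apply: (determinant_alternate ij) => a; rewrite !mxE e.
Qed.

Definition join_seq m s t (x : 'I_s -> 'I_m) (y : 'I_t -> 'I_m) (i : 'I_(s + t)) : 'I_m :=
  match split i with inl a => x a | inr b => y b end.

Lemma join_seq_l m s t (x : 'I_s -> 'I_m) (y : 'I_t -> 'I_m) a :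
  join_seq x y (lshift t a) = x a.
Proof. by rewrite /join_seq (unsplitK (inl a)). Qed.

Lemma join_seq_r m s t (x : 'I_s -> 'I_m) (y : 'I_t -> 'I_m) b :
  join_seq x y (rshift s b) = y b.
Proof. by rewrite /join_seq (unsplitK (inr b)). Qed.

Lemma join_seq_inj m s t (x : 'I_s -> 'I_m) (y : 'I_t -> 'I_m) :
  injective x -> injective y -> (forall a b, x a != y b) -> injective (join_seq x y).
Proof.
move=> xi yi xy i j; rewrite /join_seq -{2}(splitK i) -{2}(splitK j).
case: (split i) => a; case: (split j) => b //=.
- by move=> /xi ->.
- by move=> /eqP; rewrite (negPf (xy _ _)).
- by move=> /esym/eqP; rewrite (negPf (xy _ _)).
- by move=> /yi ->.
Qed.

Lemma inversions_join m s t (x : 'I_s -> 'I_m) (y : 'I_t -> 'I_m) :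
  inversions (join_seq x y) =
  (inversions x + \sum_(a < s) \sum_(b < t) (y b < x a) + inversions y)%N.
Proof.
rewrite /inversions big_split_ord /= -big_split; congr (_ + _)%N.
  apply: eq_bigr => a _; rewrite big_mkcond big_split_ord /= -big_mkcond.
  congr (_ + _)%N; first by apply: eq_bigr => b _; rewrite !join_seq_l.
  apply: eq_bigr => b _; rewrite join_seq_l join_seq_r ifT //.
  by have := ltn_ord a; lia.
apply: eq_bigr => b _; rewrite big_mkcond big_split_ord /= big1 ?add0n => [|a _].
  rewrite [RHS]big_mkcond; apply: eq_bigr => c _.
  by rewrite ltn_add2l !join_seq_r.
by rewrite ifF //; have := ltn_ord a; lia.
Qed.

Lemma inversions_ksub k (X : ksub n k) : inversions (ksub_elt X) = 0%N.
Proof.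
rewrite /inversions big1 // => a _; rewrite big1 // => b ab.
by rewrite ltnNge ltnW ?ksub_elt_mono.
Qed.

Lemma inversions_join_ksub s t (A : ksub n s) (B : ksub n t) :
  inversions (join_seq (ksub_elt A) (ksub_elt B)) = ninv (val A) (val B).
Proof.
rewrite inversions_join !inversions_ksub addn0 add0n.
rewrite pair_big /= (eq_bigr (fun p : 'I_s * 'I_t =>
  if (ksub_elt B p.2 < ksub_elt A p.1)%N then 1 else 0)%N) => [|p _]; last by case: ltnP.
rewrite -big_mkcond sum1_card /ninv.
pose h (p : 'I_s * 'I_t) := (ksub_elt A p.1, ksub_elt B p.2).
have hinj : injective h by move=> [a b] [c d] [] /ksub_elt_inj -> /ksub_elt_inj ->.
rewrite -(card_imset _ hinj); apply: eq_card => -[x y].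
rewrite [in RHS]inE /=; apply/imsetP/and3P => [[[a b] ab [-> ->]]|[xA yB yx]].
  by rewrite !ksub_elt_in; split.
have [a ea] := ksub_elt_surj xA; have [b eb] := ksub_elt_surj yB.
exists (a, b); last by rewrite /h /= ea eb.
by rewrite unfold_in /= ea eb.
Qed.

(** Listing the columns of [A] before those of [B] absorbs the sign [ninv], and for overlapping sets
    a repeated column produces the default value 0. *)
Lemma skew_det s t (M : 'M[F]_(s + t, n)) (A : ksub n s) (B : ksub n t) :
  (if [disjoint val A & val B] then
    (-1) ^+ ninv (val A) (val B) * wcoord (plucker M) (val A :|: val B) else 0) =
  \det (colsub (join_seq (ksub_elt A) (ksub_elt B)) M).
Proof.
case: ifPn => [dAB|]; last first.
  rewrite disjoint_sym disjoints_subset => /subsetPn[y yB]; rewrite inE negbK => yA.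
  have [a ea] := ksub_elt_surj yA; have [b eb] := ksub_elt_surj yB.
  rewrite (@det_colsub_noninj _ _ _ _ _ (lshift t a) (rshift s b)) ?eq_lrshift //.
  by rewrite join_seq_l join_seq_r ea.
have cU : #|val A :|: val B| == (s + t)%N.
  rewrite cardsU (eqP (valP A)) (eqP (valP B)).
  by move: dAB; rewrite -setI_eq0 => /eqP ->; rewrite cards0 subn0.
rewrite /wcoord insubT ffunE -inversions_join_ksub -det_colsub_sort //.
  apply: join_seq_inj; [exact: ksub_elt_inj | exact: ksub_elt_inj |].
  move=> a b; apply: contraTneq dAB => e; apply/negP => /disjointFr/(_ (ksub_elt_in A a)).
  by rewrite e ksub_elt_in.
move=> i; rewrite /= in_setU /join_seq.
by case: (split i) => j; rewrite ksub_elt_in ?orbT.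
Qed.

(** Expand the columns of [M] indexed by [A] in the standard basis of F^k. What remains are
    determinants with [s] unit columns and the columns indexed by [B]; up to sign they depend only
    on the set [S] of unit vectors used, so the flattening factors through the [s]-subsets of k
    indices. *)
Lemma skew_factor k s t (M : 'M[F]_(k, n)) : k = (s + t)%N ->
  exists (L : ksub n s -> ksub k s -> F) (R : ksub k s -> ksub n t -> F),
  forall (A : ksub n s) (B : ksub n t),
  (if [disjoint val A & val B] then
    (-1) ^+ ninv (val A) (val B) * wcoord (plucker M) (val A :|: val B) else 0) =
  \sum_S L A S * R S B.
Proof.
move=> e; move: M; rewrite e => M {k e}; pose k := (s + t)%N.
(* The unit vectors are put to the left of [M], so that the mixed determinants are minors of one
   matrix. *)
pose N : 'M[F]_(k, k + n) := row_mx 1%:M M.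
pose y (phi : 'I_s -> 'I_k) (B : ksub n t) := join_seq (@lshift k n \o phi) (@rshift k n \o ksub_elt B).
pose G phi B := \det (colsub (y phi B) N).
have H (phi : {ffun 'I_s -> 'I_k}) : exists u : ksub k s -> F,
    forall B, G phi B = \sum_S u S * G (ksub_elt S) B.
  have [/injectiveP inj|/injectivePn[i [j ij e]]] := boolP (injectiveb phi); last first.
    exists (fun=> 0) => B; rewrite big1 => [|S _]; last by rewrite mul0r.
    apply: (@det_colsub_noninj _ _ _ _ _ (lshift t i) (lshift t j)).
      by rewrite (inj_eq (@lshift_inj _ _)).
    by rewrite /y !join_seq_l /= e.
  have cS : #|[set phi i | i in 'I_s]| == s by rewrite card_imset // card_ord.
  pose S0 : ksub k s := mk_ksub cS.
  have yinj (psi : 'I_s -> 'I_k) B : injective psi -> injective (y psi B).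
    move=> pinj; apply: join_seq_inj.
    - by move=> ? ? /lshift_inj /pinj.
    - by move=> ? ? /rshift_inj /ksub_elt_inj.
    - by move=> a b /=; rewrite eq_lrshift.
  have S0phi i : exists j, ksub_elt S0 j = phi i.
    by apply: ksub_elt_surj; rewrite /= imset_f.
  have phiS0 j : exists i, phi i = ksub_elt S0 j.
    by have := ksub_elt_in S0 j; rewrite /= => /imsetP[i _ ->]; exists i.
  (* The lists [y phi B] and [y (ksub_elt S0) B] sort to the same column set, and the columns of [M]
     add no inversions ([invy]), so this sign works for every [B]. *)
  pose eps : F := (-1) ^+ inversions phi * (-1) ^+ inversions (ksub_elt S0).
  have invy (psi : 'I_s -> 'I_k) B : inversions (y psi B) = inversions psi.
    rewrite inversions_join [X in (_ + X + _)%N]big1 ?addn0; last first.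
      move=> a _; rewrite big1 // => b _ /=; rewrite ltnNge ltnW //=.
      by rewrite (leq_trans (ltn_ord _)) // leq_addr.
    rewrite [X in (_ + X)%N](_ : _ = 0%N) ?addn0.
      by apply: eq_bigr.
    rewrite -(inversions_ksub B); apply: eq_bigr => a _; apply: eq_bigr => b _ /=.
    by rewrite ltn_add2l.
  have cX B : #|[set y phi B i | i : 'I_k]| == k.
    by rewrite card_imset ?card_ord //; exact: yinj.
  have Geps B : G phi B = eps * G (ksub_elt S0) B.
    pose X : ksub (k + n) k := mk_ksub (cX B).
    rewrite /G (@det_colsub_sort _ _ _ (y phi B) X); last 2 first.
    - exact: yinj.
    - by move=> i; rewrite /= imset_f.
    rewrite (@det_colsub_sort _ _ _ (y (ksub_elt S0) B) X); last 2 first.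
    - by apply: yinj; exact: ksub_elt_inj.
    - move=> i; rewrite /=; apply/imsetP; case: (split_ordP i) => [a ->|b ->].
        have [a' ea] := phiS0 a; exists (lshift t a') => //.
        by rewrite /y !join_seq_l /= ea.
      by exists (rshift s b) => //; rewrite /y !join_seq_r.
    by rewrite !invy /eps -!mulrA [X in _ = _ * X]mulrA -expr2 sqrr_sign mul1r.
  exists (fun S => if S == S0 then eps else 0) => B.
  rewrite (bigD1 S0) //= eqxx -Geps big1 ?addr0 // => S SS0.
  by rewrite (negPf SS0) mul0r.
have /(_ _)/cid-/all_sig[u uE] := H.
exists (fun A S => \sum_(phi : {ffun 'I_s -> 'I_k}) (\prod_j M (phi j) (ksub_elt A j)) * u phi S).
exists (fun S B => G (ksub_elt S) B) => A B.
rewrite skew_det.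
transitivity (\sum_(phi : {ffun 'I_s -> 'I_k}) (\prod_j M (phi j) (ksub_elt A j)) * G phi B); last first.
  under [RHS]eq_bigr do rewrite mulr_suml.
  rewrite exchange_big /=; apply: eq_bigr => phi _.
  by rewrite uE mulr_sumr; apply: eq_bigr => S _; rewrite mulrA.
under [RHS]eq_bigr do rewrite /G -det_tr /determinant mulr_sumr.
rewrite exchange_big -det_tr /determinant; apply: eq_bigr => sg _.
under [RHS]eq_bigr do rewrite mulrCA.
rewrite -mulr_sumr; congr (_ * _).
rewrite big_split_ord /=.
under [RHS]eq_bigr do rewrite big_split_ord /= mulrA -big_split /=.
have EL (phi : {ffun 'I_s -> 'I_k}) a i :
    (colsub (y phi B) N)^T (lshift t a) i = (i == phi a)%:R.
  by rewrite !mxE /y join_seq_l /= (unsplitK (inl _)) mxE.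
have ER (phi : {ffun 'I_s -> 'I_k}) b i :
    (colsub (y phi B) N)^T (rshift s b) i = M i (ksub_elt B b).
  by rewrite !mxE /y join_seq_r /= (unsplitK (inr _)).
under [RHS]eq_bigr do (under eq_bigr do rewrite EL; under [X in _ * X]eq_bigr do rewrite ER).
rewrite -mulr_suml; congr (_ * _); last first.
  by apply: eq_bigr => b _; rewrite !mxE join_seq_r.
rewrite -(bigA_distr_bigA (fun j i => M i (ksub_elt A j) * (sg (lshift t j) == i)%:R)).
apply: eq_bigr => a _; rewrite !mxE join_seq_l (bigD1 (sg (lshift t a))) //= eqxx mulr1.
by rewrite big1 ?addr0 // => i; rewrite eq_sym => /negPf ->; rewrite mulr0.
Qed.

End RankBound.

Lemma card_ksub n k : #|{: ksub n k}| = 'C(n, k).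
Proof.
rewrite card_sig -[n in RHS]card_ord -card_draws; apply: eq_card => S.
by rewrite !inE.
Qed.

Lemma rank_flatmx_plucker (F : numFieldType) n k s (M : 'M[F]_(k, n)) : (s <= k)%N ->
  (\rank (flatmx s (plucker M)) <= 'C(k, s))%N.
Proof.
move=> sk; have [|L [R LR]] := @skew_factor F n k s (k - s) M; first by rewrite subnKC.
rewrite -card_ksub.
pose Lm : 'M[F]_(#|{: ksub n s}|, #|{: ksub k s}|) :=
  \matrix_(i, j) L (enum_val i) (enum_val j).
pose Rm : 'M[F]_(#|{: ksub k s}|, #|{: ksub n (k - s)}|) :=
  \matrix_(i, j) R (enum_val i) (enum_val j).
rewrite (_ : flatmx s (plucker M) = Lm *m Rm).
  by rewrite (leq_trans (mxrankM_maxl _ _)) // rank_leq_col.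
apply/matrixP => i j; rewrite !mxE /skewflat LR (reindex (@enum_val (ksub k s) {: ksub k s})).
  by apply: eq_bigr => l _; rewrite !mxE.
exact/onW_bij/enum_val_bij.
Qed.

Lemma flatmxD (F : numFieldType) n k s (z1 z2 : wedge F n k) :
  flatmx s (z1 + z2) = flatmx s z1 + flatmx s z2.
Proof.
apply/matrixP => i j; rewrite !mxE -[in RHS](mul1r (skewflat z1 _ _)) -skewflat_linear.
by congr skewflat; apply/ffunP => S; rewrite !ffunE mul1r.
Qed.

(** * Sums of three decomposable vectors *)

Definition sum3_grass (F : numFieldType) n k (z : wedge F n k) :=
  exists z1 z2 z3, [/\ grass_cone z1, grass_cone z2, grass_cone z3 & z = z1 + z2 + z3].

Lemma sum3_grass_minors_zero (F : numFieldType) n k s (z : wedge F n k) : (s <= k)%N ->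
  sum3_grass z -> @minors_zero F n k s (3 * 'C(k, s)).+1 z.
Proof.
move=> sk [_ [_ [_ [[M1 ->] [M2 ->] [M3 ->] ->]]]]; apply/minors_zeroP.
rewrite ltnS !flatmxD.
have -> : (3 * 'C(k, s) = 'C(k, s) + 'C(k, s) + 'C(k, s))%N by lia.
rewrite (leq_trans (mxrank_add _ _)) // leq_add ?rank_flatmx_plucker //.
by rewrite (leq_trans (mxrank_add _ _)) // leq_add ?rank_flatmx_plucker.
Qed.

Definition dplucker (F : fieldType) n k (M N : 'M[F]_(k, n)) (X : ksub n k) : F :=
  \sum_i plucker (subst_row M N i) X.

Lemma sum3_grass_curve (F : numFieldType) n k (M1 M2 M3 N1 N2 N3 : 'M[F]_(k, n)) :
  exists g : ksub n k -> {poly F}, [/\ curve_in (@sum3_grass F n k) g,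
    forall t X, (g X).[t] = plucker (M1 + t *: N1) X + plucker (M2 + t *: N2) X
          + plucker (M3 + t *: N3) X,
    forall X, (g X)`_0 = plucker M1 X + plucker M2 X + plucker M3 X &
    forall X, (g X)`_1 = dplucker M1 N1 X + dplucker M2 N2 X + dplucker M3 N3 X].
Proof.
exists (fun X => plucker_line M1 N1 X + plucker_line M2 N2 X + plucker_line M3 N3 X).
have hornerD3 (p q r : {poly F}) t : (p + q + r).[t] = p.[t] + q.[t] + r.[t].
  by rewrite !hornerD.
have coefD3 (p q r : {poly F}) j : (p + q + r)`_j = p`_j + q`_j + r`_j.
  by rewrite !coefD.
have gE t X : (plucker_line M1 N1 X + plucker_line M2 N2 X + plucker_line M3 N3 X).[t] =
   plucker (M1 + t *: N1) X + plucker (M2 + t *: N2) X + plucker (M3 + t *: N3) X.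
  by rewrite hornerD3; congr (_ + _ + _); exact: plucker_lineE.
split=> [t|//|X|X].
- exists (plucker (M1 + t *: N1)), (plucker (M2 + t *: N2)), (plucker (M3 + t *: N3)).
  split; [by exists (M1 + t *: N1) | by exists (M2 + t *: N2) | by exists (M3 + t *: N3) |].
  by apply/ffunP => X; rewrite ffunE gE !ffunE.
- by rewrite coefD3; congr (_ + _ + _); exact: plucker_line_coef0.
- by rewrite coefD3; congr (_ + _ + _); exact: plucker_line_coef1.
Qed.

Lemma zirreducible_sum3 (F : numFieldType) n k :
  zirreducible (zclosure (@sum3_grass F n k)).
Proof.
apply: zirreducible_zclosure.
  exists (plucker 0 + plucker 0 + plucker 0), (plucker 0), (plucker 0), (plucker 0).
  by split=> //; exists 0.
move=> _ _ [_ [_ [_ [[M1 ->] [M2 ->] [M3 ->] ->]]]] [_ [_ [_ [[N1 ->] [N2 ->] [N3 ->] ->]]]].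
have [g [Gg gE _ _]] := sum3_grass_curve M1 M2 M3 (N1 - M1) (N2 - M2) (N3 - M3).
exists g; split=> //; apply/ffunP => X; rewrite ffunE gE ?scale0r ?addr0 ?scale1r.
  by rewrite !ffunE.
by rewrite ![_ + (_ - _)]addrC !subrK !ffunE.
Qed.

(** * Auxiliary facts on finite sets and on sparse determinants *)

Lemma subset_between (T : finType) (P D : {set T}) m : P \subset D ->
  (#|P| <= m <= #|D|)%N -> exists A : {set T}, [/\ P \subset A, A \subset D & #|A| = m].
Proof.
move=> PD /andP[Pm mD]; elim: m Pm mD => [|m IH] Pm mD.
  by exists P; split=> //; apply/eqP; rewrite -leqn0.
move: Pm; rewrite leq_eqVlt => /orP[/eqP e|Pm]; first by exists P.
have [A [PA AD cA]] := IH Pm (ltnW mD).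
have /properP[_ [x xD xA]] : A \proper D by rewrite properEcard AD cA.
exists (x |: A); split; first by rewrite (subset_trans PA) ?subsetUr.
  by rewrite subUset sub1set xD.
by rewrite cardsU1 xA cA.
Qed.

(** Removing elements one at a time leads down to layer [a]. Two sets of that layer are joined by
    exchanging single elements through layer [a + 1], which is available because [a < b]. *)
Lemma layer_constant (T : finType) (V : Type) (D : {set T}) (h : {set T} -> V) a b : (a < b)%N ->
  (forall (Y : {set T}) l, Y \subset D -> l \in D -> l \notin Y -> (a <= #|Y|)%N -> (#|Y| < b)%N ->
     h (l |: Y) = h Y) ->
  forall Y Y' : {set T}, Y \subset D -> Y' \subset D -> (a <= #|Y| <= b)%N -> (a <= #|Y'| <= b)%N ->
  h Y = h Y'.
Proof.
move=> ab H.
have down (Y : {set T}) : Y \subset D -> (a <= #|Y| <= b)%N ->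
    exists Z : {set T}, [/\ Z \subset D, #|Z| = a & h Y = h Z].
  move=> YD /andP[aY Yb]; have [m em] : exists m, #|Y| = (a + m)%N.
    by exists (#|Y| - a)%N; rewrite subnKC.
  elim: m Y em YD {aY} Yb => [|m IH] Y em YD Yb; first by exists Y; rewrite em addn0.
  have /card_gt0P[x xY] : (0 < #|Y|)%N by rewrite em addnS.
  have e := cardsD1 x Y; rewrite xY in e.
  have sub : Y :\ x \subset D by rewrite (subset_trans (subD1set _ _)).
  have [||Z [ZD cZ hZ]] := IH (Y :\ x) _ sub; [lia|lia|].
  exists Z; split=> //; rewrite -hZ -{1}(setD1K xY); apply: H => //.
  - by apply: (subsetP YD).
  - by rewrite !inE eqxx.
  - lia.
  - lia.
have flat m (Y Y' : {set T}) : Y \subset D -> Y' \subset D -> #|Y| = a -> #|Y'| = a ->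
    #|Y :\: Y'| = m -> h Y = h Y'.
  elim: m Y => [|m IH] Y YD YD' cY cY' cm.
    congr h; apply/eqP; rewrite eqEcard cY cY' leqnn andbT.
    by rewrite -setD_eq0 -cards_eq0 cm.
  have /card_gt0P[y] : (0 < #|Y :\: Y'|)%N by rewrite cm.
  rewrite inE => /andP[yY' yY].
  have cd : #|Y' :\: Y| = #|Y :\: Y'|.
    have := cardsID Y Y'; have := cardsID Y' Y; rewrite (setIC Y' Y); lia.
  have /card_gt0P[y'] : (0 < #|Y' :\: Y|)%N by rewrite cd cm.
  rewrite inE => /andP[y'Y y'Y'].
  have yy : y != y' by apply: contraNneq yY' => ->.
  have e1 : h (y' |: Y) = h Y.
    by apply: H => //; [exact: (subsetP YD') | rewrite cY | rewrite cY].
  pose Z := y' |: (Y :\ y).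
  have cZ : #|Z| = a.
    rewrite /Z cardsU1 !inE (negPf y'Y) andbF /= add1n -cY (cardsD1 y Y) yY //.
  have ZD : Z \subset D.
    rewrite /Z subUset sub1set (subsetP YD' _ y'Y') /=.
    by rewrite (subset_trans (subD1set _ _)).
  have eZ : y |: Z = y' |: Y by rewrite /Z setUCA setD1K.
  have e2 : h (y |: Z) = h Z.
    apply: H => //; [exact: (subsetP YD) | | by rewrite cZ | by rewrite cZ].
    by rewrite /Z !inE eqxx (negPf yy).
  rewrite -e1 -eZ e2; apply: IH => //.
  have -> : Z :\: Y' = (Y :\: Y') :\ y.
    apply/setP => x; rewrite /Z !inE; have [->|xy'] := eqVneq x y'.
      by rewrite y'Y' !andbF.
    by rewrite /= andbCA.
  by have := cardsD1 y (Y :\: Y'); rewrite inE yY' yY cm; lia.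
move=> Y Y' YD YD' bY bY'.
have [Z [ZD cZ ->]] := down Y YD bY; have [Z' [ZD' cZ' ->]] := down Y' YD' bY'.
exact: flat.
Qed.

Lemma disjoint_setDr (T : finType) (A X : {set T}) : [disjoint A & X :\: A].
Proof. by rewrite -setI_eq0; apply/eqP/setP => x; rewrite !inE; case: (x \in A). Qed.

Lemma card_set3_le (T : finType) (a b c : T) : (#|[set a; b; c]| <= 3)%N.
Proof.
by rewrite (leq_trans (leq_card_setU _ _)) // cards1 cards2 addn1 ltnS; case: (_ != _).
Qed.

(** Off the diagonal only row and column [i] can be nonzero. A nonidentity permutation that
    contributes must then be a transposition of [i] with some [b], and the second hypothesis kills
    these. *)
Lemma det_almost_diag (R : comNzRingType) k (A : 'M[R]_k) (i : 'I_k) :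
  (forall a b, a != i -> b != a -> b != i -> A a b = 0) ->
  (forall b, b != i -> A i b = 0 \/ A b i = 0) ->
  \det A = \prod_a A a a.
Proof.
move=> H1 H2; rewrite /determinant (bigD1 1%g) //= odd_perm1 expr0 mul1r.
rewrite [X in _ + X]big1 ?addr0; first by apply: eq_bigr => a _; rewrite perm1.
move=> s s1; suff [a a0] : exists a, A a (s a) = 0.
  by rewrite (bigD1 a) //= a0 mul0r mulr0.
apply: contrapT => N.
have nz a : A a (s a) <> 0 by move=> e; apply: N; exists a.
have sa a : a != i -> s a != a -> s a = i.
  move=> ai saa; apply/eqP; apply: contraT => sai.
  by case: (nz a); apply: H1.
have [si|si] := eqVneq (s i) i.
  case/eqP: s1; apply/permP => a; rewrite perm1.
  have [->//|ai] := eqVneq a i; apply/eqP; apply: contraT => saa.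
  by have := sa a ai saa; rewrite -si => /perm_inj e; rewrite e eqxx in ai.
have ssi : s (s i) = i.
  by apply: sa => //; rewrite (inj_eq perm_inj).
by have [e|e] := H2 (s i) si; [case: (nz i) | case: (nz (s i)); rewrite ssi].
Qed.

(** * Blocks of two indices and the base point *)

Section Blocks.
Variables (F : numFieldType) (n k : nat).
Hypothesis nk : (2 * k <= n)%N.
Implicit Types (X A B : {set 'I_n}) (R Y : {set 'I_k}) (l p q : 'I_k) (j : 'I_n).

Lemma pos_proof (l : 'I_k) (b : bool) : (2 * l + ~~ b < n)%N.
Proof. by have := ltn_ord l; case: b => /=; lia. Qed.

Definition pos l b : 'I_n := Ordinal (pos_proof l b).

(* The index 2l or 2l+1 lies in block l; indices from 2k on lie in no block. *)
Definition blk (j : 'I_n) : option 'I_k := insub j./2.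

Lemma blk_pos l b : blk (pos l b) = Some l.
Proof.
rewrite /blk (_ : (pos l b)./2 = l); last by rewrite /=; case: b => /=; lia.
by rewrite valK.
Qed.

Lemma pos_blk j l : blk j = Some l -> j = pos l (~~ odd j).
Proof.
rewrite /blk; case: insubP => // u _ e [<-]; apply: val_inj => /=; rewrite e negbK.
by have := odd_double_half j; lia.
Qed.

Lemma pos_inj l b l' b' : (pos l b == pos l' b') = (l == l') && (b == b').
Proof.
apply/eqP/andP => [e|[/eqP -> /eqP ->] //].
have /= e2 := congr1 val e; have := congr1 blk e; rewrite !blk_pos => -[ll].
by split; [apply/eqP | move: e2; rewrite ll; case: b b' {e} => [] [] //= ?; lia].
Qed.

Lemma ltn_pos l b l' b' : l != l' -> (pos l b < pos l' b')%N = (l < l')%N.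
Proof. by move=> ll /=; move: ll; rewrite -val_eqE /=; case: b b' => [] [] /=; lia. Qed.

(** A block consists of two consecutive integers, so an index outside it compares alike with both.
    This is why flips inside a block preserve signs. *)
Lemma ltn_blk j l b : blk j != Some l ->
  ((j < pos l b)%N = (j < pos l true)%N) * ((pos l b < j)%N = (pos l true < j)%N).
Proof.
move=> H; have h b' : j != pos l b' by apply: contraNneq H => ->; rewrite blk_pos.
move: (h true) (h false); rewrite -!val_eqE /=; case: b => //= h1 h2.
by split; lia.
Qed.

(** A transversal of the blocks in [R]. By convention [Y] is the set of even choices, [pos l true]
    being the index 2l. *)
Definition trans (R Y : {set 'I_k}) : {set 'I_n} := [set pos l (l \in Y) | l in R].

Lemma card_trans R Y : #|trans R Y| = #|R|.
Proof. by rewrite card_in_imset // => l l' _ _ /eqP; rewrite pos_inj => /andP[/eqP]. Qed.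

Lemma mem_trans R Y l b : (pos l b \in trans R Y) = (l \in R) && (b == (l \in Y)).
Proof.
apply/imsetP/andP => [[l' lR /eqP]|[lR /eqP ->]]; last by exists l.
by rewrite pos_inj => /andP[/eqP -> /eqP ->].
Qed.

Lemma transP (R Y : {set 'I_k}) j : reflect (exists2 l, l \in R & j = pos l (l \in Y)) (j \in trans R Y).
Proof. exact: imsetP. Qed.

Definition hits (X : {set 'I_n}) : {set 'I_k} := [set l | [exists b, pos l b \in X]].

Lemma hitsP (X : {set 'I_n}) l : reflect (exists b, pos l b \in X) (l \in hits X).
Proof. by rewrite inE; exact: existsP. Qed.

(** Exactly the obstruction to being contained in a transversal of the blocks; the basis vectors of
    bad sets lie in the kernels of the flattening of [zbase]. *)
Definition bad (X : {set 'I_n}) :=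
  [exists j in X, blk j == None] ||
  [exists l, (pos l true \in X) && (pos l false \in X)].

Lemma hits_trans X : #|X| = k -> hits X = setT -> X = trans setT [set l | pos l true \in X].
Proof.
move=> cX hX; apply/esym/eqP; rewrite eqEcard card_trans cX cardsT card_ord leqnn andbT.
apply/subsetP => _ /transP[l _ ->]; rewrite inE.
have /hitsP[[] e] : l \in hits X by rewrite hX.
  by rewrite e.
by case: (boolP (pos l true \in X)).
Qed.

Lemma bad_hits X : #|X| = k -> bad X -> hits X <> setT.
Proof.
move=> cX bX hX; have e := hits_trans cX hX.
case/orP: bX => [/existsP[j /andP[]]|/existsP[l /andP[]]].
  by rewrite e => /transP[l _ ->]; rewrite blk_pos.
by rewrite e !mem_trans !in_setT /=; case: (l \in _).
Qed.

Lemma bad_sub (X X' : {set 'I_n}) : X \subset X' -> bad X -> bad X'.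
Proof.
move=> /subsetP XX /orP[/existsP[j /andP[/XX jX jN]]|/existsP[l /andP[/XX a /XX b]]];
  apply/orP; [left | right]; apply/existsP.
  by exists j; rewrite jX jN.
by exists l; rewrite a b.
Qed.

(* Row l is [th true] e_{2l} + [th false] e_{2l+1}. *)
Definition bmx (th : bool -> F) : 'M[F]_(k, n) :=
  \matrix_(l, j) ((blk j == Some l)%:R * th (~~ odd j)).

Lemma bmx_pos th l l' b : bmx th l (pos l' b) = (l' == l)%:R * th b.
Proof.
rewrite mxE blk_pos (inj_eq Some_inj); congr (_ * th _).
by rewrite /= mul2n oddD odd_double; case: b.
Qed.

Lemma bmx_off th l j : blk j != Some l -> bmx th l j = 0.
Proof. by move=> /negPf e; rewrite mxE e mul0r. Qed.

Lemma plucker_nohit (M : 'M[F]_(k, n)) (X : ksub n k) l : l \notin hits (val X) ->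
  (forall j, blk j != Some l -> M l j = 0) -> plucker M X = 0.
Proof.
move=> lX H; rewrite ffunE (expand_det_row _ l) big1 // => a _.
rewrite mxE H ?mul0r //; apply: contra lX => /eqP /pos_blk e.
by apply/hitsP; exists (~~ odd (ksub_elt X a)); rewrite -e ksub_elt_in.
Qed.

Definition xf i j (Y : {set 'I_k}) (a : 'I_k) : 'I_n :=
  if a == i then j else pos a (a \in Y).

(** When [j] lies in another block [l], the transposition of [i] and [l] could contribute; the last
    hypothesis makes its entry in row [i] zero. *)
Lemma plucker_xf th (N : 'M[F]_(k, n)) i j Y (X : ksub n k) :
  injective (xf i j Y) -> (forall a, xf i j Y a \in val X) ->
  (forall l, l != i -> blk j = Some l -> N i (pos l (l \in Y)) = 0) ->
  plucker (subst_row (bmx th) N i) X =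
  (-1) ^+ inversions (xf i j Y) * (N i j * \prod_(a | a != i) th (a \in Y)).
Proof.
move=> xinj xX H.
rewrite ffunE; have := det_colsub_sort (subst_row (bmx th) N i) xinj xX.
move/(congr1 ( *%R ((-1) ^+ inversions (xf i j Y)))).
rewrite mulrA -expr2 sqrr_sign mul1r => <-; congr (_ * _).
rewrite (det_almost_diag (i := i)).
- rewrite (bigD1 i) //= !mxE eqxx /xf eqxx; congr (_ * _).
  apply: eq_bigr => a ai; rewrite !mxE (negPf ai).
  by have := bmx_pos th a a (a \in Y); rewrite mxE eqxx mul1r.
- move=> a b ai ba bi; rewrite !mxE (negPf ai) /xf (negPf bi).
  by rewrite blk_pos (inj_eq Some_inj) (negPf ba) mul0r.
- move=> b bi; have [e|e] := eqVneq (blk j) (Some b).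
    by left; rewrite !mxE eqxx /xf (negPf bi) H.
  by right; rewrite !mxE (negPf bi) /xf eqxx (negPf e) mul0r.
Qed.

Lemma inversions_pos Y : inversions (fun a => pos a (a \in Y)) = 0%N.
Proof.
rewrite /inversions big1 // => a _; rewrite big1 // => b ab.
by rewrite ltn_pos ?(ltnNge b) ?(ltnW ab) //; apply: contraTneq ab => ->; rewrite ltnn.
Qed.

Lemma xf_own i Y : xf i (pos i (i \in Y)) Y =1 (fun a => pos a (a \in Y)).
Proof. by move=> a; rewrite /xf; case: eqP => // ->. Qed.

Lemma pos_set_inj Y : injective (fun a => pos a (a \in Y)).
Proof. by move=> a b /eqP; rewrite pos_inj => /andP[/eqP]. Qed.

Lemma dplucker_trans th (N : 'M[F]_(k, n)) Y (X : ksub n k) : val X = trans setT Y ->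
  dplucker (bmx th) N X =
  \sum_i N i (pos i (i \in Y)) * \prod_(a | a != i) th (a \in Y).
Proof.
move=> eX; apply: eq_bigr => i _.
rewrite (@plucker_xf _ _ i (pos i (i \in Y)) Y).
- rewrite (_ : inversions _ = 0%N) ?expr0 ?mul1r // -(inversions_pos Y).
  by congr inversions; apply/funext; exact: xf_own.
- by move=> a b; rewrite !xf_own => /pos_set_inj.
- by move=> a; rewrite xf_own eX mem_trans inE eqxx.
- by move=> l li; rewrite blk_pos => -[e]; rewrite e eqxx in li.
Qed.

Lemma plucker_trans th Y (X : ksub n k) : val X = trans setT Y ->
  plucker (bmx th) X = \prod_a th (a \in Y).
Proof.
move=> eX; rewrite ffunE.
have xX a : pos a (a \in Y) \in val X by rewrite eX mem_trans inE eqxx.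
have := det_colsub_sort (bmx th) (@pos_set_inj Y) xX.
rewrite inversions_pos mul1r => <-.
rewrite -det_tr det_trig.
  apply: eq_bigr => a _; rewrite !mxE; have := bmx_pos th a a (a \in Y).
  by rewrite mxE eqxx mul1r.
apply/is_trig_mxP => a b ab; rewrite !mxE blk_pos (inj_eq Some_inj).
by rewrite -val_eqE (ltn_eqF ab) mul0r.
Qed.

(** The set [X] misses block [i], so replacing any other row leaves row [i] equal to zero on [X]:
    one term of the derivative survives. *)
Lemma dplucker_xf th (N : 'M[F]_(k, n)) i j Y (X : ksub n k) :
  blk j != Some i ->
  injective (xf i j Y) -> val X = [set xf i j Y a | a in setT] ->
  (forall l, l != i -> blk j = Some l -> N i (pos l (l \in Y)) = 0) ->
  dplucker (bmx th) N X =
  (-1) ^+ inversions (xf i j Y) * (N i j * \prod_(a | a != i) th (a \in Y)).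
Proof.
move=> ji xinj eX H; rewrite /dplucker (bigD1 i) //= big1 ?addr0 => [|b bi].
  by apply: plucker_xf => // a; rewrite eX imset_f // inE.
apply: (@plucker_nohit _ _ i).
  apply/hitsP => -[c]; rewrite eX => /imsetP[a _]; rewrite /xf.
  case: eqP => [_ e|/eqP ai /eqP]; first by case/eqP: ji; rewrite -e blk_pos.
  by rewrite pos_inj eq_sym (negPf ai).
by move=> j' h; rewrite mxE eq_sym (negPf bi) bmx_off.
Qed.

Lemma dplucker_miss th (N : 'M[F]_(k, n)) (X : ksub n k) l1 l2 :
  l1 != l2 -> l1 \notin hits (val X) -> l2 \notin hits (val X) ->
  dplucker (bmx th) N X = 0.
Proof.
move=> l12 h1 h2; rewrite /dplucker big1 // => i _.
have [e|e] := eqVneq l1 i.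
  apply: (plucker_nohit h2) => j jb.
  by rewrite mxE -e eq_sym (negPf l12) bmx_off.
by apply: (plucker_nohit h1) => j jb; rewrite mxE (negPf e) bmx_off.
Qed.

(** * Coordinates of the base point *)

Definition th1 (b : bool) : F := b%:R.
Definition th2 (b : bool) : F := (~~ b)%:R.
Definition th3 (b : bool) : F := 1.

(* e_0 /\ e_2 /\ .. /\ e_{2k-2} + e_1 /\ e_3 /\ .. /\ e_{2k-1} + (e_0 + e_1) /\ .. /\ (e_{2k-2} + e_{2k-1}),
   the base point of the tangent space computation. *)
Definition zbase : wedge F n k :=
  plucker (bmx th1) + plucker (bmx th2) + plucker (bmx th3).

Lemma prod_bool (P : pred 'I_k) (f : 'I_k -> bool) :
  \prod_(a | P a) (f a)%:R = [forall (a | P a), f a]%:R :> F.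
Proof.
case: (boolP [forall (a | P a), f a]) => [/forall_inP H|].
  by rewrite big1 // => a /H ->.
by rewrite negb_forall_in => /exists_inP[a Pa /negPf fa]; rewrite (bigD1 a) //= fa mul0r.
Qed.

Lemma zbase_nohit X : hits X != setT -> wcoord zbase X = 0.
Proof.
rewrite -subTset => /subsetPn[l _ lX]; rewrite /wcoord; case: insubP => // u _ eu.
rewrite !ffunE -!(ffunE (fun S => \det (colsub (ksub_elt S) (bmx _)))) -/(plucker _).
by rewrite !(@plucker_nohit _ _ l) ?eu ?addr0 // => j; exact: bmx_off.
Qed.

Lemma zbase_trans Y : wcoord zbase (trans setT Y) = (Y == setT)%:R + (Y == set0)%:R + 1.
Proof.
have c : #|trans setT Y| == k by rewrite card_trans cardsT card_ord.
rewrite /wcoord insubT /= /zbase !ffunE.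
rewrite -!(ffunE (fun S => \det (colsub (ksub_elt S) (bmx _)))) -/(plucker _).
rewrite !(@plucker_trans _ Y) // /th1 /th2 /th3 !prod_bool big1 //.
congr ((nat_of_bool _)%:R + (nat_of_bool _)%:R + 1).
  apply/idP/eqP => [/forallP H|->]; last by apply/forallP => a; rewrite inE.
  by apply/setP => a; rewrite inE; exact: (H a).
apply/idP/eqP => [/forallP H|->]; last by apply/forallP => a; rewrite inE.
by apply/setP => a; rewrite inE; apply/negbTE; exact: (H a).
Qed.

Lemma zbase_mixed X p q : #|X| = k -> hits X = setT -> pos p true \in X -> pos q false \in X ->
  wcoord zbase X = 1.
Proof.
move=> cX hX pX qX; rewrite (hits_trans cX hX) zbase_trans.
set Y := [set l | _].
have pY : p \in Y by rewrite inE.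
have qY : q \notin Y.
  by move: qX; rewrite {1}(hits_trans cX hX) mem_trans inE /= -/Y; case: (q \in Y).
have YT : (Y == setT) = false by apply: contraNF qY => /eqP ->; rewrite in_setT.
have Y0 : (Y == set0) = false by apply: contraTF pY => /eqP ->; rewrite in_set0.
by rewrite YT Y0 !add0r.
Qed.

(** * Flips inside a block and kernel vectors of the base point *)

Definition flip l : {perm 'I_n} := tperm (pos l true) (pos l false).

Lemma flip_pos l b : flip l (pos l b) = pos l (~~ b).
Proof. by rewrite /flip; case: b; rewrite ?tpermL ?tpermR. Qed.

Lemma flip_off l j : blk j != Some l -> flip l j = j.
Proof. by move=> h; rewrite tpermD //; apply: contraNneq h => <-; rewrite blk_pos. Qed.

Lemma flip_pos_off l a b : a != l -> flip l (pos a b) = pos a b.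
Proof. by move=> al; rewrite flip_off // blk_pos (inj_eq Some_inj). Qed.

Lemma flip_blk l j : blk (flip l j) = blk j.
Proof.
have [e|e] := eqVneq (blk j) (Some l); last by rewrite flip_off.
by rewrite (pos_blk e) flip_pos !blk_pos.
Qed.

Lemma mem_flip l (X : {set 'I_n}) j : (flip l j \in flip l @: X) = (j \in X).
Proof. by rewrite mem_imset //; exact: perm_inj. Qed.

Lemma mem_flip_off l (X : {set 'I_n}) a b : a != l -> (pos a b \in flip l @: X) = (pos a b \in X).
Proof. by move=> al; rewrite -{1}(flip_pos_off b al) mem_flip. Qed.

Lemma flip_trans R Y l : l \notin Y -> flip l @: trans R Y = trans R (l |: Y).
Proof.
move=> lY; rewrite /trans -imset_comp; apply: eq_imset => a /=.
rewrite !inE; have [->|al] := eqVneq a l; first by rewrite flip_pos (negPf lY).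
by rewrite flip_pos_off.
Qed.

Definition avoids l (X : {set 'I_n}) := l \notin hits X.

Lemma avoids_blk l X j : avoids l X -> j \in X -> blk j != Some l.
Proof.
move=> h jX; apply: contra h => /eqP e; apply/hitsP.
by exists (~~ odd j); rewrite -(pos_blk e).
Qed.

Lemma flip_avoids l X : avoids l X -> flip l @: X = X.
Proof.
move=> h; apply/setP => j; apply/imsetP/idP => [[i iX ->]|jX].
  by rewrite flip_off // (avoids_blk h).
by exists j => //; rewrite flip_off // (avoids_blk h).
Qed.

Lemma card_flip l (X : {set 'I_n}) : #|flip l @: X| = #|X|.
Proof. by rewrite card_imset //; exact: perm_inj. Qed.

Lemma hits_flip l X : hits (flip l @: X) = hits X.
Proof.
apply/setP => a; apply/hitsP/hitsP => -[b].
  case/imsetP => j jX /(congr1 blk); rewrite flip_blk blk_pos => /esym /pos_blk e.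
  by exists (~~ odd j); rewrite -e.
move=> aX; have [e|e] := eqVneq a l.
  by exists (~~ b); rewrite e -flip_pos mem_flip -e.
by exists b; rewrite mem_flip_off.
Qed.

Lemma flip_ltn l j j' : blk j' != Some l ->
  ((flip l j < j')%N = (j < j')%N) * ((j' < flip l j)%N = (j' < j)%N).
Proof.
move=> h; have [e|e] := eqVneq (blk j) (Some l); last by rewrite flip_off.
by rewrite (pos_blk e) flip_pos !(ltn_blk _ h).
Qed.

Lemma ninv_flipl l (A B : {set 'I_n}) : avoids l B -> ninv (flip l @: A) B = ninv A B.
Proof.
move=> aB; pose h (p : 'I_n * 'I_n) := (flip l p.1, p.2).
have hi : injective h by move=> [a b] [c d] [] /perm_inj -> ->.
rewrite /ninv -[RHS](card_imset _ hi); apply: eq_card => -[x y].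
rewrite inE /=; apply/and3P/imsetP => [[xA yB yx]|[[a b]]].
  have [a aA xa] := imsetP xA; exists (a, y); rewrite ?inE /h /= ?xa //.
  by rewrite aA yB -(flip_ltn a (avoids_blk aB yB)) -xa.
rewrite inE /= => /and3P[aA bB ba] [-> ->].
by rewrite mem_flip (flip_ltn a (avoids_blk aB bB)).
Qed.

Lemma ninv_flipr l (A B : {set 'I_n}) : avoids l A -> ninv A (flip l @: B) = ninv A B.
Proof.
move=> aA; pose h (p : 'I_n * 'I_n) := (p.1, flip l p.2).
have hi : injective h by move=> [a b] [c d] [] -> /perm_inj ->.
rewrite /ninv -[RHS](card_imset _ hi); apply: eq_card => -[x y].
rewrite inE /=; apply/and3P/imsetP => [[xA yB yx]|[[a b]]].
  have [b bB yb] := imsetP yB; exists (x, b); rewrite ?inE /h /= ?yb //.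
  by rewrite xA bB -(flip_ltn b (avoids_blk aA xA)) -yb.
rewrite inE /= => /and3P[xA bB ba] [-> ->].
by rewrite mem_flip (flip_ltn b (avoids_blk aA xA)).
Qed.

(** [skewflat] on bare sets, so that flipped sets need no new cardinality proofs. *)
Definition skset (z : wedge F n k) (A B : {set 'I_n}) : F :=
  if [disjoint A & B] then (-1) ^+ ninv A B * wcoord z (A :|: B) else 0.

(* Flipping l in A gives a second row of the flattening of zbase equal to that of A. *)
Definition movable l (A : {set 'I_n}) := l \in hits A /\
  exists p q, [/\ p != l, q != l, pos p true \in A & pos q false \in A].

Lemma zbase_flip l X p q : p != l -> q != l -> pos p true \in X -> pos q false \in X ->
  wcoord zbase (flip l @: X) = wcoord zbase X.
Proof.
move=> pl ql pX qX; have [cX|cX] := eqVneq #|X| k; last first.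
  by rewrite /wcoord !insubF ?card_flip ?(negPf cX).
have [hX|hX] := eqVneq (hits X) setT; last by rewrite !zbase_nohit ?hits_flip.
rewrite (@zbase_mixed X p q) // (@zbase_mixed _ p q) ?card_flip ?hits_flip //.
  by rewrite mem_flip_off.
by rewrite mem_flip_off.
Qed.

Lemma zbase_bad X : bad X -> wcoord zbase X = 0.
Proof.
move=> bX; have [cX|cX] := eqVneq #|X| k; last by rewrite /wcoord insubF ?(negPf cX).
by rewrite zbase_nohit //; apply/eqP; exact: bad_hits.
Qed.

Lemma bad_overlap l A B : l \in hits A -> l \in hits B -> [disjoint A & B] -> bad (A :|: B).
Proof.
move=> /hitsP[b bA] /hitsP[c cB] dAB; apply/orP; right; apply/existsP; exists l.
have bc : b != c by apply: contraTneq cB => <-; rewrite (disjointFr dAB bA).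
by move: bA cB; rewrite !inE; case: b c bc => [] [] // _ -> ->; rewrite ?orbT.
Qed.

(** If [B] meets block [l], each entry is zero, by overlap or because the union is bad. Otherwise
    the flip moves the union, whose coordinate is unchanged because of the even and odd witnesses
    [p] and [q]. *)
Lemma skset_flipl l A B : movable l A -> skset zbase (flip l @: A) B = skset zbase A B.
Proof.
move=> [lA [p [q [pl ql pA qA]]]]; rewrite /skset.
have [lB|lB] := boolP (l \in hits B).
  rewrite (_ : (if _ then _ else _) = 0).
    by case: ifP => // d; rewrite zbase_bad ?mulr0 //; exact: bad_overlap lB d.
  by case: ifP => // d; rewrite zbase_bad ?mulr0 //; apply: bad_overlap lB d; rewrite hits_flip.
rewrite ninv_flipl // -{1 3}(flip_avoids lB) -imsetU.
rewrite (@zbase_flip l (A :|: B) p q) ?inE ?pA ?qA //.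
rewrite -setI_eq0 -imsetI; last by move=> ? ? _ _ /perm_inj.
by rewrite imset_eq0 setI_eq0.
Qed.

Lemma skset_flipr l A B : movable l B -> skset zbase A (flip l @: B) = skset zbase A B.
Proof.
move=> [lB [p [q [pl ql pB qB]]]]; rewrite /skset.
have [lA|lA] := boolP (l \in hits A).
  rewrite (_ : (if _ then _ else _) = 0).
    by case: ifP => // d; rewrite zbase_bad ?mulr0 //; exact: bad_overlap lA _ d.
  by case: ifP => // d; rewrite zbase_bad ?mulr0 //; apply: bad_overlap lA _ d; rewrite hits_flip.
rewrite ninv_flipr // -{1 3}(flip_avoids lA) -imsetU.
rewrite (@zbase_flip l (A :|: B) p q) ?inE ?pB ?qB ?orbT //.
rewrite -setI_eq0 -imsetI; last by move=> ? ? _ _ /perm_inj.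
by rewrite imset_eq0 setI_eq0.
Qed.

Lemma skset_badl A B : bad A -> skset zbase A B = 0.
Proof.
by move=> bA; rewrite /skset zbase_bad ?mulr0 ?if_same //; apply: bad_sub bA; exact: subsetUl.
Qed.

Lemma skset_badr A B : bad B -> skset zbase A B = 0.
Proof.
by move=> bA; rewrite /skset zbase_bad ?mulr0 ?if_same //; apply: bad_sub bA; exact: subsetUr.
Qed.

(** * The tangent space at the base point *)

Section TangentRelations.
Variables (s : nat) (w : wedge F n k).
Hypotheses (s3 : (3 <= s)%N) (sk : (2 * s <= k)%N).
Hypothesis tw : forall (a : 'rV_#|{: ksub n s}|) (b : 'cV_#|{: ksub n (k - s)}|),
  a *m flatmx s zbase = 0 -> flatmx s zbase *m b = 0 -> a *m flatmx s w *m b = 0.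

Let ra (A : ksub n s) : 'rV[F]_#|{: ksub n s}| := delta_mx 0 (enum_rank A).
Let cb (B : ksub n (k - s)) : 'cV[F]_#|{: ksub n (k - s)}| := delta_mx (enum_rank B) 0.

Let raE (A : ksub n s) (z : wedge F n k) i : (ra A *m flatmx s z) 0 i = skset z (val A) (val (enum_val i)).
Proof. by rewrite -rowE !mxE enum_rankK. Qed.

Let cbE (z : wedge F n k) i (B : ksub n (k - s)) :
  (flatmx s z *m cb B) i 0 = skset z (val (enum_val i)) (val B).
Proof. by rewrite -colE !mxE enum_rankK. Qed.

Let rcE (A : ksub n s) (z : wedge F n k) (B : ksub n (k - s)) :
  (ra A *m flatmx s z *m cb B) 0 0 = skset z (val A) (val B).
Proof. by rewrite -colE mxE raE enum_rankK. Qed.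

Let ra_eq0 (a : 'rV_#|{: ksub n s}|) :
  (forall i, (a *m flatmx s zbase) 0 i = 0) -> a *m flatmx s zbase = 0.
Proof. by move=> H; apply/rowP => i; rewrite H mxE. Qed.

Let cb_eq0 (b : 'cV_#|{: ksub n (k - s)}|) :
  (forall i, (flatmx s zbase *m b) i 0 = 0) -> flatmx s zbase *m b = 0.
Proof. by move=> H; apply/colP => j; rewrite H mxE. Qed.

(** The digits in the names give the two kernel vectors paired: 0 for the basis vector of a bad set,
    1 for the difference of a flipped pair. *)
Let tan00 A B : #|A| = s -> #|B| = (k - s)%N -> bad A -> bad B -> skset w A B = 0.
Proof.
move=> /eqP cA /eqP cB bA bB.
have ea : ra (mk_ksub cA) *m flatmx s zbase = 0.
  by apply: ra_eq0 => j; rewrite raE skset_badl.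
have eb : flatmx s zbase *m cb (mk_ksub cB) = 0.
  by apply: cb_eq0 => i; rewrite cbE skset_badr.
by have /matrixP/(_ 0 0) := tw ea eb; rewrite rcE [X in _ = X]mxE.
Qed.

Let tan01 l A B : #|A| = s -> #|B| = (k - s)%N -> bad A -> movable l B ->
  skset w A (flip l @: B) = skset w A B.
Proof.
move=> /eqP cA cB bA mB.
have /eqP cB' : #|flip l @: B| = (k - s)%N by rewrite card_flip.
move/eqP: cB => cB.
have ea : ra (mk_ksub cA) *m flatmx s zbase = 0.
  by apply: ra_eq0 => j; rewrite raE skset_badl.
have eb : flatmx s zbase *m (cb (mk_ksub cB') - cb (mk_ksub cB)) = 0.
  by apply: cb_eq0 => i; rewrite mulmxBr mxE [X in _ + X]mxE !cbE skset_flipr ?subrr.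
have /matrixP/(_ 0 0) := tw ea eb.
rewrite mulmxBr mxE [X in _ + X]mxE !rcE [X in _ = X]mxE => /eqP.
by rewrite subr_eq0 => /eqP.
Qed.

Let tan11 i l A B : #|A| = s -> #|B| = (k - s)%N -> movable i A -> movable l B ->
  skset w (flip i @: A) (flip l @: B) - skset w (flip i @: A) B
  - (skset w A (flip l @: B) - skset w A B) = 0.
Proof.
move=> cA cB mA mB.
have /eqP cA' : #|flip i @: A| = s by rewrite card_flip.
have /eqP cB' : #|flip l @: B| = (k - s)%N by rewrite card_flip.
move/eqP: cB => cB; move/eqP: cA => cA.
have ea : (ra (mk_ksub cA') - ra (mk_ksub cA)) *m flatmx s zbase = 0.
  by apply: ra_eq0 => j; rewrite mulmxBl mxE [X in _ + X]mxE !raE skset_flipl ?subrr.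
have eb : flatmx s zbase *m (cb (mk_ksub cB') - cb (mk_ksub cB)) = 0.
  by apply: cb_eq0 => j; rewrite mulmxBr mxE [X in _ + X]mxE !cbE skset_flipr ?subrr.
have /matrixP/(_ 0 0) := tw ea eb.
have mxB (x y : 'M[F]_1) : (x - y) 0 0 = x 0 0 - y 0 0 by rewrite !mxE.
by rewrite !mulmxBl !mulmxBr !mxB [X in _ = X]mxE !rcE => <-; ring.
Qed.

Let sign_skset (z : wedge F n k) A B : [disjoint A & B] ->
  wcoord z (A :|: B) = (-1) ^+ ninv A B * skset z A B.
Proof. by rewrite /skset => ->; rewrite mulrA -expr2 sqrr_sign mul1r. Qed.

Lemma tangent_bad_bad A B : #|A| = s -> #|B| = (k - s)%N -> bad A -> bad B ->
  [disjoint A & B] -> wcoord w (A :|: B) = 0.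
Proof. by move=> cA cB bA bB d; rewrite sign_skset // tan00 ?mulr0. Qed.

Let disjoint_flip l A B : [disjoint flip l @: A & flip l @: B] = [disjoint A & B].
Proof.
rewrite -!setI_eq0 -imsetI; last by move=> ? ? _ _ /perm_inj.
by rewrite imset_eq0.
Qed.

Lemma tangent_bad_flip l A B : #|A| = s -> #|B| = (k - s)%N -> bad A -> movable l B ->
  avoids l A -> [disjoint A & B] ->
  wcoord w (flip l @: (A :|: B)) = wcoord w (A :|: B).
Proof.
move=> cA cB bA mB aA d; rewrite imsetU [LHS]sign_skset ?disjoint_flip //.
by rewrite (flip_avoids aA) tan01 // ninv_flipr // -sign_skset.
Qed.

Lemma tangent_flip_flip i l A B : #|A| = s -> #|B| = (k - s)%N ->
  movable i A -> movable l B -> avoids l A -> avoids i B -> [disjoint A & B] ->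
  wcoord w (flip i @: (flip l @: (A :|: B))) =
  wcoord w (flip i @: (A :|: B)) + wcoord w (flip l @: (A :|: B)) - wcoord w (A :|: B).
Proof.
move=> cA cB mA mB aA aB d.
have aB' : avoids i (flip l @: B) by rewrite /avoids hits_flip.
have aA' : avoids l (flip i @: A) by rewrite /avoids hits_flip.
rewrite !imsetU !sign_skset ?disjoint_flip //.
rewrite (flip_avoids aA) (flip_avoids aB) (flip_avoids aB').
rewrite (ninv_flipr B aA') !(ninv_flipl _ aB) (ninv_flipr B aA) -mulrDr -mulrBr.
congr (_ * _); apply/eqP; rewrite -subr_eq0; apply/eqP.
by rewrite -[RHS](tan11 cA cB mA mB); ring.
Qed.

(** * Sets that miss a block *)

Definition cell j : {set 'I_n} :=
  if blk j is Some l then [set pos l true; pos l false] else [set j].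

(* The elements of X in excess of one per block. *)
Definition excess X : {set 'I_n} :=
  [set j in X | (blk j == None) ||
     [exists l, (j == pos l false) && (pos l true \in X)]].

Lemma mem_cell j : j \in cell j.
Proof.
rewrite /cell; case e: (blk j) => [l|]; last by rewrite inE.
by rewrite {1}(pos_blk e) !inE !pos_inj eqxx; case: (odd j).
Qed.

Lemma cell_blk i j : i \in cell j -> blk i = blk j /\ (blk j = None -> i = j).
Proof.
rewrite /cell; case e: (blk j) => [l|].
  by rewrite !inE => /orP[] /eqP ->; rewrite blk_pos.
by rewrite inE => /eqP ->; rewrite e.
Qed.

Lemma card_cell j : (#|cell j| <= 2)%N.
Proof. by rewrite /cell; case: (blk j) => [l|]; rewrite ?cards2 ?cards1 //; case: (_ != _). Qed.

Lemma bad_cell j : bad (cell j).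
Proof.
apply/orP; rewrite /cell; case e: (blk j) => [l|]; [right | left]; apply/existsP.
  by exists l; rewrite !inE !eqxx orbT.
by exists j; rewrite inE eqxx e.
Qed.

Lemma excess_cell X j : j \in excess X -> cell j \subset X.
Proof.
rewrite inE => /andP[jX /orP[/eqP e|/existsP[l /andP[/eqP ej tX]]]].
  by rewrite /cell e sub1set.
by rewrite /cell ej blk_pos subUset !sub1set tX -ej.
Qed.

Lemma excess_blk X j l : j \in excess X -> blk j = Some l ->
  j = pos l false /\ pos l true \in X.
Proof.
rewrite inE => /andP[jX /orP[/eqP ->|/existsP[l' /andP[/eqP -> tX]]]] //.
by rewrite blk_pos => -[<-].
Qed.

Lemma excess_disjoint X j1 j2 : j1 \in excess X -> j2 \in excess X -> j1 != j2 ->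
  [disjoint cell j1 & cell j2].
Proof.
move=> h1 h2 j12; rewrite -setI_eq0; apply/eqP/setP => x; rewrite !inE.
apply/negbTE/andP => -[/cell_blk[b1 n1] /cell_blk[b2 n2]].
case/eqP: j12; case e: (blk x) => [l|].
  by have [-> _] := excess_blk h1 (etrans (esym b1) e);
     have [-> _] := excess_blk h2 (etrans (esym b2) e).
exact: etrans (esym (n1 (etrans (esym b1) e))) (n2 (etrans (esym b2) e)).
Qed.

(** After removal of the excess, [blk] maps the remaining elements injectively into the blocks that
    are hit. *)
Lemma card_excess X : (#|X| <= #|excess X| + #|hits X|)%N.
Proof.
have eX : excess X \subset X by apply/subsetP => x; rewrite inE => /andP[].
rewrite -(cardsID (excess X) X) (setIidPr eX) leq_add2l.
have -> : #|hits X| = #|Some @: hits X| by rewrite card_imset //; exact: Some_inj.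
have ne j : j \in X -> j \notin excess X -> exists l, blk j = Some l.
  by move=> jX; rewrite inE jX /=; case: (blk j) => [l|//]; exists l.
have key b c l : pos l b \in X -> pos l c \in X ->
    pos l b \notin excess X -> pos l c \notin excess X -> b = c.
  have K : pos l true \in X -> pos l false \in X -> pos l false \in excess X.
    by move=> t f; rewrite inE f; apply/orP; right; apply/existsP; exists l; rewrite eqxx.
  by case: b c => [] [] // h1 h2 n1 n2; [rewrite K // in n2 | rewrite K // in n1].
have inj : {in X :\: excess X &, injective blk}.
  move=> x y /setDP[xX xE] /setDP[yX yE].
  have [l e] := ne x xX xE; rewrite e => /esym e'.
  move: xX yX xE yE; rewrite (pos_blk e) (pos_blk e') => h1 h2 n1 n2.
  by congr pos; exact: key h1 h2 n1 n2.
rewrite -(card_in_imset inj).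
apply/subset_leq_card/subsetP => _ /imsetP[j /setDP[jX jE] ->].
have [l e] := ne j jX jE; rewrite e imset_f //; apply/hitsP.
by exists (~~ odd j); rewrite -(pos_blk e).
Qed.

Let s2 : (2 <= s)%N. Proof. by lia. Qed.
Let sk2 : (s <= k - 2)%N. Proof. by lia. Qed.
Let sk3 : (s <= k - 3)%N. Proof. by lia. Qed.
Let k6 : (6 <= k)%N. Proof. by lia. Qed.

(** Missing two blocks forces two excess elements, whose cells are disjoint and bad. Splitting [X]
    with one cell on each side pairs two bad sets. *)
Lemma tangent_miss2 X : #|X| = k -> (#|hits X|.+2 <= k)%N -> wcoord w X = 0.
Proof.
move=> cX hX; have := card_excess X; rewrite cX => ce.
have [j1 [j2 [h1 h2 j12]]] : exists j1 j2, [/\ j1 \in excess X, j2 \in excess X & j1 != j2].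
  have /card_gt1P[j1 [j2 [? ? ?]]] : (1 < #|excess X|)%N by lia.
  by exists j1, j2.
have d := excess_disjoint h1 h2 j12.
have c1 := card_cell j1; have c2 := card_cell j2.
have cX1 := excess_cell h1; have cX2 := excess_cell h2.
have [||A [PA AD cA]] := @subset_between _ (cell j1) (X :\: cell j2) s.
- by rewrite subsetD cX1.
- rewrite cardsD (setIidPr cX2) cX (leq_trans c1 s2) /=.
  exact: leq_trans sk2 (leq_sub2l k c2).
have AX : A \subset X by rewrite (subset_trans AD) ?subsetDl.
rewrite (_ : X = A :|: (X :\: A)); last by rewrite -{1}(setID X A) (setIidPr AX).
apply: tangent_bad_bad => //.
- by rewrite cardsD (setIidPr AX) cX cA.
- exact: bad_sub PA (bad_cell _).
- apply: bad_sub (bad_cell j2); rewrite subsetD cX2 disjoint_sym.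
  by move: AD; rewrite subsetD => /andP[].
- exact: disjoint_setDr.
Qed.

Definition others i j : {set 'I_k} := [set l | (l != i) && (blk j != Some l)].

(** The shape of the [k]-subsets that miss only block [i]; only the part of [Y] inside [others i j]
    matters. *)
Definition one_excess i j Y : {set 'I_n} := cell j :|: trans (others i j) Y.

Lemma cell_trans_disjoint i j Y : [disjoint cell j & trans (others i j) Y].
Proof.
rewrite -setI_eq0; apply/eqP/setP => x; rewrite !inE; apply/negbTE/andP.
by move=> [/cell_blk[b _] /transP[l]]; rewrite inE -b => /andP[_ h] e; rewrite e blk_pos eqxx in h.
Qed.

Lemma card_others i j : blk j != Some i -> (#|cell j| + #|others i j| = k)%N.
Proof.
rewrite /cell /others; case e : (blk j) => [l|] h.
  rewrite (_ : [set _ | _] = ~: [set i; l]); last first.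
    by apply/setP => a; rewrite !inE negb_or (inj_eq Some_inj) (eq_sym l).
  have := cardsC [set i; l]; rewrite !cards2 card_ord pos_inj eqxx /=.
  by rewrite (_ : i != l) //; apply: contraNneq h => ->.
rewrite (_ : [set _ | _] = ~: [set i]); last by apply/setP => a; rewrite !inE andbT.
by have := cardsC [set i]; rewrite !cards1 card_ord.
Qed.

Lemma card_one_excess i j Y : blk j != Some i -> #|one_excess i j Y| = k.
Proof.
move=> h; rewrite /one_excess cardsU -(card_others h) card_trans.
have := cell_trans_disjoint i j Y; rewrite -setI_eq0 => /eqP ->.
by rewrite cards0 subn0.
Qed.

Lemma mem_one_excess i j Y l b : l \in others i j ->
  (pos l b \in one_excess i j Y) = (b == (l \in Y)).
Proof.
move=> lR; rewrite inE mem_trans lR /=; case: (boolP (_ \in cell j)) => //.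
by move=> /cell_blk[e _]; move: lR; rewrite inE -e blk_pos eqxx andbF.
Qed.

Lemma flip_cell l j : blk j != Some l -> flip l @: cell j = cell j.
Proof.
move=> h; apply: flip_avoids; apply/hitsP => -[b /cell_blk[e _]].
by rewrite -e blk_pos eqxx in h.
Qed.

(** Put [cell j] in [A], which makes it bad, and keep in [B] the index to flip together with an even
    witness [p] and an odd witness [q]. The bounds on [Y] provide the witnesses. *)
Lemma tangent_one_excess_flip i j Y l : blk j != Some i -> Y \subset others i j ->
  l \in others i j -> l \notin Y -> (1 <= #|Y|)%N -> (#|Y|.+1 < #|others i j|)%N ->
  wcoord w (one_excess i j (l |: Y)) = wcoord w (one_excess i j Y).
Proof.
move=> h YR lR lY Y1 Y2.
have /card_gt0P[p pY] := Y1.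
have /card_gt0P[q] : (0 < #|others i j :\: (l |: Y)|)%N.
  have lYR : l |: Y \subset others i j by rewrite subUset sub1set lR.
  by rewrite cardsD (setIidPr lYR) cardsU1 lY subn_gt0.
rewrite !inE negb_or -andbA => /and3P[ql qY]; rewrite -/(others i j) => qi.
have qR : q \in others i j by rewrite inE.
have pR := subsetP YR _ pY.
have pl : p != l by apply: contraNneq lY => <-.
have pq : p != q by apply: contraNneq qY => <-.
set X := one_excess i j Y.
have cX : #|X| = k by exact: card_one_excess.
pose P := [set pos l false; pos p true; pos q false].
have PX : P \subset X.
  by rewrite !subUset !sub1set !mem_one_excess // (negPf lY) pY (negPf qY).
have cP : (#|P| <= 3)%N := card_set3_le _ _ _.
have cj := card_cell j.
have cellX : cell j \subset X :\: P.
  rewrite subsetD subsetUl /= -setI_eq0; apply/eqP/setP => x; rewrite !inE; apply/negbTE/andP.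
  move=> [/cell_blk[b _]].
  by case/orP; [case/orP|] => /eqP e; [move: lR|move: pR|move: qR];
     rewrite inE -b e blk_pos eqxx andbF.
have [||A [PA AD cA]] := @subset_between _ (cell j) (X :\: P) s => //.
  rewrite cardsD (setIidPr PX) cX (leq_trans cj s2) /=.
  exact: leq_trans sk3 (leq_sub2l k cP).
have AX : A \subset X by rewrite (subset_trans AD) ?subsetDl.
have eX : X = A :|: (X :\: A) by rewrite -{1}(setID X A) (setIidPr AX).
have PB : P \subset X :\: A.
  by rewrite subsetD PX disjoint_sym; move: AD; rewrite subsetD => /andP[].
have -> : one_excess i j (l |: Y) = flip l @: X.
  rewrite /X /one_excess imsetU flip_trans // flip_cell //.
  by move: lR; rewrite inE => /andP[].
rewrite eX; apply: tangent_bad_flip => //.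
- by rewrite cardsD (setIidPr AX) cX cA.
- exact: bad_sub PA (bad_cell _).
- split; first by apply/hitsP; exists false; rewrite (subsetP PB) // !inE eqxx.
  by exists p, q; split=> //; rewrite (subsetP PB) // !inE eqxx ?orbT.
- apply/hitsP => -[b bA]; have := subsetP AX _ bA; rewrite mem_one_excess // (negPf lY).
  move=> /eqP e; have := subsetP AD _ bA; rewrite e !inE eqxx //.
- exact: disjoint_setDr.
Qed.

Lemma tangent_one_excess_middle i j Y Y' : blk j != Some i ->
  Y :&: others i j != set0 -> ~~ (others i j \subset Y) ->
  Y' :&: others i j != set0 -> ~~ (others i j \subset Y') ->
  wcoord w (one_excess i j Y) = wcoord w (one_excess i j Y').
Proof.
move=> h Y0 Y1 Y0' Y1'.
have red Z : one_excess i j Z = one_excess i j (Z :&: others i j).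
  by rewrite /one_excess /trans; congr (_ :|: _); apply: eq_in_imset => l lR; rewrite inE lR andbT.
have bnd Z : Z :&: others i j != set0 -> ~~ (others i j \subset Z) ->
    (1 <= #|Z :&: others i j| <= #|others i j|.-1)%N.
  rewrite card_gt0 => -> /= Z1; have : Z :&: others i j \proper others i j.
    by rewrite properE subsetIr /=; apply: contra Z1 => /subsetIP[].
  by move=> /proper_card; case: #|others i j|.
have c := card_others h; have c2 := card_cell j.
rewrite (red Y) (red Y').
apply: (@layer_constant _ _ (others i j) (fun Z => wcoord w (one_excess i j Z)) 1 #|others i j|.-1).
- lia.
- move=> Z l ZR lR lZ Z1 Z2; apply: tangent_one_excess_flip => //.
  by case: #|others i j| Z2.
- exact: subsetIr.
- exact: subsetIr.
- exact: bnd.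
- exact: bnd.
Qed.

(* The split X = A + B used here needs i, p, q in A and l, p', q' in B,
   which is where s >= 3 and k - s >= 3 enter. *)
Lemma tangent_square i l Y : i != l -> i \notin Y -> l \notin Y ->
  (2 <= #|Y|)%N -> (#|Y| + 4 <= k)%N ->
  wcoord w (trans setT (i |: (l |: Y))) =
  wcoord w (trans setT (i |: Y)) + wcoord w (trans setT (l |: Y))
  - wcoord w (trans setT Y).
Proof.
move=> il iY lY Y2 Yk.
have /card_gt1P[p [p' [pY pY' pp]]] : (1 < #|Y|)%N by [].
have cC := cardsC (i |: (l |: Y)); rewrite card_ord in cC.
have cU : #|i |: (l |: Y)| = (#|Y|.+2)%N by rewrite !cardsU1 !inE (negPf il) (negPf iY) (negPf lY).
have /card_gt1P[q [q' [qC qC' qq]]] : (1 < #|~: (i |: (l |: Y))|)%N by lia.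
have [qi ql qY] : [/\ q != i, q != l & q \notin Y] by move: qC; rewrite !inE !negb_or => /and3P[].
have [qi' ql' qY'] : [/\ q' != i, q' != l & q' \notin Y] by move: qC'; rewrite !inE !negb_or => /and3P[].
have [pi pl] : p != i /\ p != l by split; [apply: contraNneq iY => <- | apply: contraNneq lY => <-].
have [pi' pl'] : p' != i /\ p' != l by split; [apply: contraNneq iY => <- | apply: contraNneq lY => <-].
have pq : p != q by apply: contraNneq qY => <-.
have pq' : p != q' by apply: contraNneq qY' => <-.
have p'q : p' != q by apply: contraNneq qY => <-.
have p'q' : p' != q' by apply: contraNneq qY' => <-.
set X := trans setT Y.
have cX : #|X| = k by rewrite card_trans cardsT card_ord.
pose P := [set pos i false; pos p true; pos q false].
pose Q := [set pos l false; pos p' true; pos q' false].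
have PX : P \subset X.
  by rewrite !subUset !sub1set !mem_trans !inE (negPf iY) pY (negPf qY).
have QX : Q \subset X.
  by rewrite !subUset !sub1set !mem_trans !inE (negPf lY) pY' (negPf qY').
have cP : (#|P| <= 3)%N := card_set3_le _ _ _.
have cQ : (#|Q| <= 3)%N := card_set3_le _ _ _.
have PQ : P \subset X :\: Q.
  rewrite subsetD PX /= -setI_eq0; apply/eqP/setP => x; rewrite !inE; apply/negbTE/andP.
  move=> [/orP[/orP[]|] /eqP ->]; rewrite !pos_inj ?andbF ?andbT ?orbF /=.
  - by rewrite (negPf il) (eq_sym i q') (negPf qi').
  - by rewrite (negPf pp).
  - by rewrite (negPf ql) (negPf qq).
have [||A [PA AD cA]] := @subset_between _ P (X :\: Q) s => //.
  rewrite cardsD (setIidPr QX) cX (leq_trans cP s3) /=.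
  exact: leq_trans sk3 (leq_sub2l k cQ).
have AX : A \subset X by rewrite (subset_trans AD) ?subsetDl.
have eX : X = A :|: (X :\: A) by rewrite -{1}(setID X A) (setIidPr AX).
have QB : Q \subset X :\: A.
  by rewrite subsetD QX disjoint_sym; move: AD; rewrite subsetD => /andP[].
have iY' : i \notin l |: Y by rewrite !inE negb_or il.
rewrite -(flip_trans _ iY') -(flip_trans _ iY) -(flip_trans _ lY) -/X eX.
apply: tangent_flip_flip => //.
- by rewrite cardsD (setIidPr AX) cX cA.
- split; first by apply/hitsP; exists false; rewrite (subsetP PA) // !inE eqxx.
  by exists p, q; split=> //; rewrite (subsetP PA) // !inE eqxx ?orbT.
- split; first by apply/hitsP; exists false; rewrite (subsetP QB) // !inE eqxx.
  by exists p', q'; split=> //; rewrite (subsetP QB) // !inE eqxx ?orbT.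
- apply/hitsP => -[b bA]; have := subsetP AX _ bA; rewrite mem_trans (negPf lY) => /andP[_ /eqP e].
  by have := subsetP AD _ bA; rewrite e !inE eqxx.
- apply/hitsP => -[b]; rewrite inE mem_trans (negPf iY) => /and3P[bA _ /eqP e].
  by case/negP: bA; rewrite e (subsetP PA) // !inE eqxx.
- exact: disjoint_setDr.
Qed.

(** The square relation holds for sets of size 2 to k - 4, so the increment in direction [l] is
    constant for sizes 2 to k - 3. Subtracting these increments leaves a function constant for sizes
    2 to k - 2. *)
Lemma tangent_affine : exists (c0 : F) (c : 'I_k -> F), forall Y,
  (2 <= #|Y|)%N -> (#|Y| + 2 <= k)%N -> wcoord w (trans setT Y) = c0 + \sum_(l in Y) c l.
Proof.
pose f Y := wcoord w (trans setT Y).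
have cT : #|[set: 'I_k]| = k by rewrite cardsT card_ord.
have slope l : exists c, forall Y, l \notin Y -> (2 <= #|Y|)%N -> (#|Y| + 3 <= k)%N ->
    f (l |: Y) - f Y = c.
  have cD : #|[set~ l]| = k.-1 by have := cardsC [set l]; rewrite cards1 card_ord; lia.
  have [||Y0 [_ Y0D cY0]] := @subset_between _ set0 [set~ l] 2; rewrite ?sub0set ?cards0 ?cD //.
    by lia.
  exists (f (l |: Y0) - f Y0) => Y lY Y2 Yk.
  apply: (@layer_constant _ _ [set~ l] (fun Y => f (l |: Y) - f Y) 2 (k - 3)) => //.
  - lia.
  - move=> Z i ZD iD iZ Z2 Zk.
    have lZ : l \notin Z by apply: contraTN isT => /(subsetP ZD); rewrite !inE eqxx.
    have il : i != l by move: iD; rewrite !inE.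
    have Zk' : (#|Z| + 4 <= k)%N by move: Zk k6; move: #|Z| => m; clear; lia.
    by rewrite /f (tangent_square _ lZ iZ Z2 Zk') 1?eq_sym //; ring.
  - by rewrite subsetC sub1set inE.
  - by rewrite Y2; move: Yk; move: #|Y| => m; clear; lia.
  - by rewrite cY0; move: k6; clear; lia.
have /(_ _)/cid-/all_sig[c hc] := slope.
have [||Y0 [_ Y0D cY0]] := @subset_between _ set0 [set: 'I_k] 2; rewrite ?sub0set ?cards0 ?cT //.
  by lia.
pose g Y := f Y - \sum_(l in Y) c l.
exists (g Y0), c => Y Y2 Yk.
have <- : g Y = g Y0.
  apply: (@layer_constant _ _ setT g 2 (k - 2)) => //.
  - lia.
  - move=> Z i _ _ iZ Z2 Zk; rewrite /g big_setU1 //= -(hc i Z) //; first by ring.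
    by move: Zk k6; move: #|Z| => m; clear; lia.
  - by rewrite Y2; move: Yk; move: #|Y| => m; clear; lia.
  - by rewrite cY0; move: k6; clear; lia.
by rewrite /g subrK.
Qed.

(** * Realising a tangent vector by three matrices *)

Definition class_rep j Y := forall l, blk j = Some l -> j = pos l (~~ (l \in Y)).

Lemma xf_inj i j Y : class_rep j Y -> injective (xf i j Y).
Proof.
move=> hj a b; rewrite /xf; case: eqP => [->|_]; case: eqP => [->|_] //.
- move=> e; have := hj b; rewrite e blk_pos => /(_ erefl) /eqP.
  by rewrite pos_inj eqxx; case: (b \in Y).
- move=> e; have := hj a; rewrite -e blk_pos => /(_ erefl) /eqP.
  by rewrite pos_inj eqxx; case: (a \in Y).
- by move/eqP; rewrite pos_inj => /andP[/eqP].
Qed.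

Lemma xf_image i j Y : blk j != Some i -> class_rep j Y ->
  [set xf i j Y a | a in setT] = one_excess i j Y.
Proof.
move=> h hj; apply/eqP; rewrite eqEcard card_one_excess // card_imset; last exact: xf_inj.
rewrite cardsT card_ord leqnn andbT; apply/subsetP => _ /imsetP[a _ ->]; rewrite /xf.
case: eqP => [_|/eqP ai]; first by rewrite inE mem_cell.
have [e|e] := eqVneq (blk j) (Some a); last by rewrite mem_one_excess // inE ai.
rewrite inE /cell e; case: (a \in Y); rewrite !inE eqxx ?orbT //.
Qed.

(** The sign depends only on the choice in the block of [j], so a single matrix entry can serve all
    the sets [one_excess i j Y]. *)
Lemma xf_inversions i j Y Y' : (forall l, blk j = Some l -> (l \in Y) = (l \in Y')) ->
  inversions (xf i j Y) = inversions (xf i j Y').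
Proof.
move=> H; apply: eq_bigr => a _; apply: eq_bigr => b ab; congr nat_of_bool.
have ab' : b != a by apply: contraTneq ab => ->; rewrite ltnn.
have K c : ((j < pos c (c \in Y))%N = (j < pos c (c \in Y'))%N) *
           ((pos c (c \in Y) < j)%N = (pos c (c \in Y') < j)%N).
  have [e|e] := eqVneq (blk j) (Some c); first by rewrite (H _ e).
  by rewrite !(ltn_blk _ e).
rewrite /xf; case: eqP => [_|_]; case: eqP => [_|_] //; rewrite ?K //.
by rewrite !ltn_pos.
Qed.

Lemma one_excessP X i : #|X| = k -> i \notin hits X -> (k <= #|hits X|.+1)%N ->
  exists j Y, [/\ blk j != Some i, class_rep j Y & X = one_excess i j Y].
Proof.
move=> cX iX hX; have ce := card_excess X.
have hXi : hits X = ~: [set i].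
  apply/eqP; rewrite eqEcard; apply/andP; split.
    by apply/subsetP => l lX; rewrite !inE; apply: contraNneq iX => <-.
  by have := cardsC [set i]; rewrite cards1 card_ord; lia.
have /card_gt0P[j jE] : (0 < #|excess X|)%N.
  have := cardsC [set i]; rewrite cards1 card_ord -hXi; lia.
have jX := excess_cell jE.
have ji : blk j != Some i.
  apply: contra iX => /eqP e; apply/hitsP; exists (~~ odd j); rewrite -(pos_blk e).
  by rewrite (subsetP jX) // mem_cell.
exists j, [set l | pos l true \in X]; split=> //.
  by move=> l e; have [-> tX] := excess_blk jE e; rewrite inE tX.
apply/esym/eqP; rewrite eqEcard card_one_excess // cX leqnn andbT subUset jX.
apply/subsetP => _ /transP[l lR ->]; rewrite inE.
have /hitsP[[] e] : l \in hits X by move: lR; rewrite hXi !inE => /andP[].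
  by rewrite e.
by case: (boolP (pos l true \in X)).
Qed.

Lemma middle_const i j : exists c, forall Y, blk j != Some i ->
  Y :&: others i j != set0 -> ~~ (others i j \subset Y) ->
  wcoord w (one_excess i j Y) = c.
Proof.
have [[Y [h Y0 Y1]]|N] := lem (exists Y, [/\ blk j != Some i,
    Y :&: others i j != set0 & ~~ (others i j \subset Y)]).
  exists (wcoord w (one_excess i j Y)) => Y' _ Y0' Y1'.
  exact: tangent_one_excess_middle.
(* Default value when no choice is properly mixed. *)
by exists 0 => Y h Y0 Y1; case: N; exists Y.
Qed.

Lemma prod_th1 i Y : \prod_(a | a != i) th1 (a \in Y) = (~: [set i] \subset Y)%:R.
Proof.
rewrite prod_bool; congr (nat_of_bool _)%:R; apply/forall_inP/subsetP => H a; last first.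
  by move=> ai; apply: H; rewrite !inE.
by rewrite !inE; apply: H.
Qed.

Lemma prod_th2 i Y : \prod_(a | a != i) th2 (a \in Y) = (Y \subset [set i])%:R.
Proof.
rewrite prod_bool; congr (nat_of_bool _)%:R; apply/forall_inP/subsetP => H a.
  by move=> aY; rewrite inE; apply: contraLR aY; apply: H.
by move=> ai; apply: contra ai => /H; rewrite inE.
Qed.

Lemma sum_average (x : F) : (0 < k)%N -> \sum_(i < k) x / k%:R = x.
Proof.
by move=> k0; rewrite sumr_const card_ord -[LHS]mulr_natr divfK // pnatr_eq0 -lt0n.
Qed.

(** The full set sees every row, so its value is spread evenly over them; the complement of one
    block [l] sees row [l] alone, at its odd index. [sum_rank1] is the dual statement. *)
Lemma sum_corank1 (u : 'I_k -> F) (g : {set 'I_k} -> F) Y :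
  (0 < k)%N -> (forall i, u i = if i \in Y then g setT / k%:R else g (~: [set i])) ->
  \sum_i u i * (~: [set i] \subset Y)%:R = if (k.-1 <= #|Y|)%N then g Y else 0.
Proof.
move=> k0 ue; have [YT|] := eqVneq Y setT.
  rewrite (eq_bigr (fun=> g setT / k%:R)) => [|i _]; last first.
    by rewrite ue YT subsetT mulr1 in_setT.
  by rewrite sum_average // YT cardsT card_ord leq_pred.
rewrite -subTset => /subsetPn[l _ lY]; rewrite (bigD1 l) //= big1 ?addr0; last first.
  move=> i il; rewrite (_ : (_ \subset _) = false) ?mulr0 //.
  by apply/negbTE/subsetPn; exists l => //; rewrite !inE eq_sym.
have YD : Y \subset ~: [set l] by rewrite subsetC sub1set inE.
have cD : #|~: [set l]| = k.-1 by have := cardsC [set l]; rewrite cards1 card_ord; lia.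
rewrite ue (negPf lY) -cD.
have -> : (#|~: [set l]| <= #|Y|)%N = (~: [set l] \subset Y).
  by rewrite (geq_leqif (subset_leqif_cards YD)) eqEsubset YD.
case: ifP => e; rewrite ?mulr0 // mulr1; congr g.
by apply/eqP; rewrite eqEsubset YD e.
Qed.

Lemma sum_rank1 (u : 'I_k -> F) (g : {set 'I_k} -> F) Y :
  (0 < k)%N -> (forall i, u i = if i \in Y then g [set i] else g set0 / k%:R) ->
  \sum_i u i * (Y \subset [set i])%:R = if (#|Y| <= 1)%N then g Y else 0.
Proof.
move=> k0 ue; have [Y0|[l lY]] := set_0Vmem Y.
  rewrite (eq_bigr (fun=> g set0 / k%:R)) => [|i _]; last first.
    by rewrite ue Y0 sub0set in_set0 mulr1.
  by rewrite sum_average // Y0 cards0.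
rewrite (bigD1 l) //= big1 ?addr0; last first.
  move=> i il; rewrite (_ : (_ \subset _) = false) ?mulr0 //.
  by apply/negbTE/subsetPn; exists l => //; rewrite !inE eq_sym.
have lD : [set l] \subset Y by rewrite sub1set.
rewrite ue lY.
have -> : (#|Y| <= 1)%N = (Y \subset [set l]).
  by rewrite -(cards1 l) (geq_leqif (subset_leqif_cards lD)) eqEsubset lD.
case: ifP => e; rewrite ?mulr0 // mulr1; congr g.
by apply/eqP; rewrite eqEsubset lD e.
Qed.

(** The two indices of a block give the same sets [one_excess]; this fixes one of them, so that both
    get the same constant. *)
Definition norm j : 'I_n := if blk j is Some l then pos l false else j.

Lemma blk_norm j : blk (norm j) = blk j.
Proof. by rewrite /norm; case e: (blk j) => [l|]; rewrite ?blk_pos ?e. Qed.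

Lemma one_excess_norm i j Y : one_excess i (norm j) Y = one_excess i j Y.
Proof.
rewrite /one_excess /others blk_norm; congr (_ :|: _).
by rewrite /cell blk_norm /norm; case e: (blk j) => [l|].
Qed.

Lemma one_excess_congr i j j' Y Y' : blk j = blk j' -> cell j = cell j' ->
  (forall l, l \in others i j -> (l \in Y) = (l \in Y')) ->
  one_excess i j Y = one_excess i j' Y'.
Proof.
move=> eb ec H; rewrite /one_excess -ec /others -eb; congr (_ :|: _).
by apply: eq_in_imset => l lR; rewrite H.
Qed.

Lemma wcoord_val (z : wedge F n k) (X : ksub n k) : wcoord z (val X) = z X.
Proof. by rewrite /wcoord valK. Qed.

Lemma tangent_image : exists N1 N2 N3 : 'M[F]_(k, n), forall X : ksub n k,
  w X = dplucker (bmx th1) N1 X + dplucker (bmx th2) N2 X + dplucker (bmx th3) N3 X.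
Proof.
have k0 : (0 < k)%N by lia.
have kn0 : k%:R != 0 :> F by rewrite pnatr_eq0 -lt0n.
have [c0 [c aff]] := tangent_affine.
have /(_ _)/cid-/all_sig[cc0 cc0E] := fun ij : 'I_k * 'I_n => middle_const ij.1 ij.2.
pose cc i j := cc0 (i, norm j).
have ccE i j Y : blk j != Some i -> Y :&: others i j != set0 ->
    ~~ (others i j \subset Y) -> wcoord w (one_excess i j Y) = cc i j.
  move=> h Y0 Y1; rewrite -one_excess_norm; apply: (cc0E (i, norm j)); rewrite /= ?blk_norm //.
    by rewrite /others blk_norm.
  by rewrite /others blk_norm.
(* The deviation from the affine function, zero for sizes 2 to k - 2. *)
pose f Y := wcoord w (trans setT Y) - (c0 + \sum_(l in Y) c l).
pose sg i j Y : F := (-1) ^+ inversions (xf i j Y).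
pose isT j := (blk j != None) && ~~ odd j.
pose isF j := (blk j != None) && odd j.
(* [N3] produces the generic values: the affine function on transversals and the constants [cc] when
   one block is missed. [N1] and [N2] correct the choices that are even, respectively odd, up to at
   most one block on transversals, and on all of [others i j] when a block is missed. The entries
   set to 0 are those required by [dplucker_xf]. *)
pose N3 : 'M[F]_(k, n) := \matrix_(i, j)
  if blk j == Some i then c0 / k%:R + (~~ odd j)%:R * c i
  else if isT j then 0 else sg i j setT * cc i j.
pose N1 : 'M[F]_(k, n) := \matrix_(i, j)
  if blk j == Some i then (if odd j then f (~: [set i]) else f setT / k%:R)
  else if isT j then 0 else sg i j setT * (wcoord w (one_excess i j setT) - cc i j).
pose N2 : 'M[F]_(k, n) := \matrix_(i, j)
  if blk j == Some i then (if odd j then f set0 / k%:R else f [set i])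
  else if isF j then 0 else sg i j set0 * (wcoord w (one_excess i j set0) - cc i j).
have oddp l b : odd (pos l b) = ~~ b by rewrite /= mul2n oddD odd_double; case: b.
exists N1, N2, N3 => X; rewrite -wcoord_val.
have cX : #|val X| = k := eqP (valP X).
have chits := cardsC (hits (val X)); rewrite card_ord in chits.
have [h2|h2] := leqP (#|hits (val X)|.+2) k.
  have /card_gt1P[l1 [l2 [l1X l2X l12]]] : (1 < #|~: hits (val X)|)%N by lia.
  rewrite !inE in l1X l2X.
  by rewrite tangent_miss2 // !(@dplucker_miss _ _ _ l1 l2) ?inE // !addr0.
have [hX|] := eqVneq (hits (val X)) setT.
  have eX := hits_trans cX hX; set Y := [set l | _] in eX.
  rewrite !(dplucker_trans _ _ eX) eX -[LHS](subrK (c0 + \sum_(l in Y) c l)) -/(f Y).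
  congr (_ + _).
    under eq_bigr do rewrite prod_th1.
    under [X in _ = _ + X]eq_bigr do rewrite prod_th2.
    rewrite (@sum_corank1 _ f) // => [|a]; last by rewrite mxE blk_pos eqxx oddp; case: (a \in Y).
    rewrite (@sum_rank1 _ f) // => [|a]; last by rewrite mxE blk_pos eqxx oddp; case: (a \in Y).
    case: leqP => [h1|h1]; case: leqP => [h3|h3]; rewrite ?addr0 ?add0r //.
      by move: h1 h3; lia.
    by rewrite /f aff ?subrr //; lia.
  rewrite [RHS](eq_bigr (fun i => c0 / k%:R + (i \in Y)%:R * c i)); last first.
    by move=> i _; rewrite mxE blk_pos eqxx oddp negbK /th3 big1 ?mulr1.
  rewrite big_split /= sum_average //; congr (_ + _).
  rewrite big_mkcond; apply: eq_bigr => i _.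
  by case: (i \in Y); rewrite ?mul1r ?mul0r.
rewrite -subTset => /subsetPn[i _ iX].
have [|j [Y [ji hj eX]]] := one_excessP cX iX; first by lia.
set R := others i j in ji hj eX *.
have cR := card_others ji; have cj := card_cell j.
pose S : {set 'I_k} := [set l | blk j == Some l].
(* A doubled block can be listed in two ways. For [th1] its even index must count as the choice, so
   the odd one is the extra column [j1]; for [th2] the roles are exchanged. [th3] allows both and
   uses [j1]. *)
pose j1 := norm j; pose j2 := if blk j is Some l then pos l true else j.
pose Y1 := Y :|: S; pose Y2 := Y :\: S.
have b1 : blk j1 = blk j by exact: blk_norm.
have b2 : blk j2 = blk j by rewrite /j2; case e: (blk j) => [l|] //; rewrite blk_pos.
have c1 : cell j1 = cell j by rewrite /cell b1 /j1 /norm; case: (blk j).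
have c2 : cell j2 = cell j by rewrite /cell b2 /j2; case: (blk j).
have iT l : blk j1 = Some l -> (l \in Y1) /\ (l \in Y2) = false.
  by rewrite b1 => e; rewrite !inE e eqxx orbT.
have hj1 : class_rep j1 Y1.
  move=> l e; rewrite (iT l e).1 /= /j1 /norm.
  by move: e; rewrite b1 => ->.
have hj2 : class_rep j2 Y2.
  move=> l; rewrite b2 -b1 => e; rewrite (iT l e).2 /= /j2.
  by move: e; rewrite b1 => ->.
have ji1 : blk j1 != Some i by rewrite b1.
have ji2 : blk j2 != Some i by rewrite b2.
have inR l : l \in R -> blk j != Some l by rewrite inE => /andP[].
have Y1R l : l \in R -> (l \in Y) = (l \in Y1).
  by move=> /inR e; rewrite !inE (negPf e) orbF.
have Y2R l : l \in R -> (l \in Y) = (l \in Y2).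
  by move=> /inR e; rewrite !inE (negPf e).
have eX1 : val X = [set xf i j1 Y1 a | a in setT].
  by rewrite xf_image // eX; apply: one_excess_congr.
have eX2 : val X = [set xf i j2 Y2 a | a in setT].
  by rewrite xf_image // eX; apply: one_excess_congr.
have N1E := @dplucker_xf th1 N1 i j1 Y1 X ji1 (xf_inj hj1) eX1.
have N3E := @dplucker_xf th3 N3 i j1 Y1 X ji1 (xf_inj hj1) eX1.
have N2E := @dplucker_xf th2 N2 i j2 Y2 X ji2 (xf_inj hj2) eX2.
have sg1 : inversions (xf i j1 Y1) = inversions (xf i j1 setT).
  by apply: xf_inversions => l e; rewrite (iT l e).1 inE.
have sg2 : inversions (xf i j2 Y2) = inversions (xf i j2 set0).
  by apply: xf_inversions => l; rewrite b2 -b1 => e; rewrite (iT l e).2 inE.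
have isT1 : isT j1 = false.
  by rewrite /isT b1 /j1 /norm; case: (blk j) => [l|] //; rewrite oddp.
have isF2 : isF j2 = false.
  by rewrite /isF b2 /j2; case: (blk j) => [l|] //; rewrite oddp.
have blkS l : l != i -> blk j1 = Some l -> (Some l == Some i) = false.
  by move=> li _; rewrite (inj_eq Some_inj) (negPf li).
rewrite N1E ?N2E ?N3E; first last.
- by move=> l li e; rewrite mxE blk_pos blkS // (iT l e).1 /isT blk_pos oddp.
- by move=> l li; rewrite b2 -b1 => e; rewrite mxE blk_pos blkS // (iT l e).2 /isF blk_pos oddp.
- by move=> l li e; rewrite mxE blk_pos blkS // (iT l e).1 /isT blk_pos oddp.
rewrite !mxE (negPf ji1) (negPf ji2) isT1 isF2 sg1 sg2 /sg !mulrA -!expr2 !sqrr_sign !mul1r.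
rewrite prod_th1 prod_th2 /th3 big1 ?mulr1 //.
have cc12 : cc i j2 = cc i j1.
  by rewrite /cc /j1 /j2; case e : (blk j) => [l|]; rewrite /norm ?e ?blk_pos.
have oT : one_excess i j1 setT = one_excess i j setT by exact: one_excess_congr.
have o0 : one_excess i j2 set0 = one_excess i j set0 by exact: one_excess_congr.
have cc1 : cc i j1 = cc i j.
  by rewrite /cc /j1; case e : (blk j) => [l|]; rewrite /norm ?e ?blk_pos.
rewrite oT o0 cc12 cc1 eX.
have -> : (~: [set i] \subset Y1) = (R \subset Y).
  apply/subsetP/subsetP => H l.
    move=> lR; rewrite (Y1R l lR); apply: H; rewrite !inE.
    by move: lR; rewrite inE => /andP[].
  rewrite !inE => li; have [//|e] := boolP (blk j == Some l); rewrite ?orbT ?orbF //.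
  by apply: H; rewrite inE li.
have -> : (Y2 \subset [set i]) = (Y :&: R == set0).
  apply/subsetP/eqP => H; last first.
    move=> l; rewrite !inE => /andP[e lY]; apply: contraT => li.
    by have /setP/(_ l) := H; rewrite !inE lY li e.
  apply/setP => l; rewrite in_set0; apply/negbTE; rewrite inE negb_and.
  rewrite -implybE; apply/implyP => lY; apply/negP => lR.
  by have := H l; rewrite -Y2R // inE => /(_ lY); move: lR; rewrite inE => /andP[/negPf ->].
have R0 : R != set0.
  by rewrite -card_gt0; move: cR cj k6; rewrite -/R; move: #|R| #|cell j|; clear; lia.
have [RY|RY] := boolP (R \subset Y).
  rewrite (setIidPr RY) (negPf R0) mulr1 mulr0 addr0 subrK.
  by congr wcoord; apply: one_excess_congr => // l lR; rewrite (subsetP RY) // inE.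
have [YR|YR] := eqVneq (Y :&: R) set0.
  rewrite mulr0 add0r mulr1 subrK; congr wcoord; apply: one_excess_congr => // l lR.
  by move/setP: YR => /(_ l); rewrite in_setI !in_set0 lR andbT => ->.
by rewrite !mulr0 !add0r; apply: ccE.
Qed.
End TangentRelations.

(** * Rank at the base point and conclusion *)

Lemma ninv_trans R R' Y Y' : [disjoint R & R'] ->
  ninv (trans R Y) (trans R' Y') = ninv R R'.
Proof.
move=> d; pose h (p : 'I_k * 'I_k) := (pos p.1 (p.1 \in Y), pos p.2 (p.2 \in Y')).
have hi : injective h.
  move=> [a b] [c e] /eqP; rewrite xpair_eqE /= !pos_inj.
  by move=> /andP[/andP[/eqP -> _] /andP[/eqP -> _]].
rewrite /ninv -[RHS](card_imset _ hi); apply: eq_card => -[x y].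
have ne a b : a \in R -> b \in R' -> b != a.
  by move=> aR; apply: contraTneq => ->; rewrite (disjointFr d aR).
rewrite inE /=; apply/and3P/imsetP => [[/transP[a aR ->] /transP[b bR ->]]|[[a b]]].
  by rewrite ltn_pos ?ne // => ba; exists (a, b); rewrite // inE /= aR bR.
rewrite inE /= => /and3P[aR bR ba] [-> ->].
by rewrite !mem_trans aR bR !eqxx ltn_pos ?ne.
Qed.

Lemma trans_setU R Y Y' : Y \subset R -> Y' \subset ~: R ->
  trans R Y :|: trans (~: R) Y' = trans setT (Y :|: Y').
Proof.
move=> YR YR'; apply/setP => j; rewrite inE; apply/orP/transP.
  have R1 l : l \in R -> (l \in Y') = false.
    by move=> lR; apply/negbTE; apply: contraTN lR => /(subsetP YR'); rewrite inE.
  have R2 l : l \in ~: R -> (l \in Y) = false.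
    by rewrite inE => lR; apply/negbTE; apply: contra lR => /(subsetP YR).
  case=> /transP[l lR ->]; exists l; rewrite ?in_setT // in_setU.
    by rewrite (R1 l lR) orbF.
  by rewrite (R2 l lR).
move=> [l _ ->]; rewrite !mem_trans !inE; have [lR|lR] := boolP (l \in R); [left|right].
  have /negbTE -> : l \notin Y' by apply: contraTN lR => /(subsetP YR'); rewrite inE.
  by rewrite orbF eqxx.
have /negbTE -> : l \notin Y by apply: contra lR => /(subsetP YR).
by rewrite eqxx.
Qed.

(* The even, the odd and one mixed choice of representatives of the blocks in R. *)
Definition pattern R (t : 'I_3) : {set 'I_k} :=
  if t == 0 then R else if t == 1 then set0 else [set l | [pick l' in R] == Some l].

Lemma pattern_sub R t : pattern R t \subset R.
Proof.
rewrite /pattern; case: ifP => _ //; case: ifP => _; first exact: sub0set.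
by apply/subsetP => l; rewrite inE; case: pickP => // x xR /eqP[<-].
Qed.

Lemma pattern2 R : (1 < #|R|)%N -> #|pattern R 2| = 1%N.
Proof.
move=> R1; rewrite /pattern /=; case: pickP => [x xR|R0].
  by rewrite -(cards1 x); apply: eq_card => l; rewrite !inE (inj_eq Some_inj) eq_sym.
by have /card_gt0P[x] := ltnW R1; rewrite (R0 x).
Qed.

Let ord3P (t : 'I_3) : [\/ t = 0, t = 1 | t = 2].
Proof.
by case: t => [[|[|[|//]]]] h; [constructor 1|constructor 2|constructor 3]; apply: val_inj.
Qed.

Lemma pattern_full R t : (1 < #|R|)%N -> (pattern R t == R) = (t == 0).
Proof.
move=> R1; case: (ord3P t) => ->; first by rewrite /pattern !eqxx.
  by apply/negbTE; rewrite /pattern /= eq_sym -card_gt0 ltnW.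
by have := pattern2 R1; case: eqP => // -> c; rewrite c in R1.
Qed.

Lemma pattern_empty R t : (1 < #|R|)%N -> (pattern R t == set0) = (t == 1).
Proof.
move=> R1; case: (ord3P t) => ->; last by apply/negbTE; rewrite -card_gt0 pattern2.
  by apply/negbTE; rewrite /pattern eqxx -card_gt0 ltnW.
by rewrite /pattern /= !eqxx.
Qed.

(** For fixed [R] this is the 3 by 3 matrix with all entries 1, plus the diagonal matrix with
    entries 1, 1, 0: it is invertible. *)
Lemma zbase_pattern R t t' : (1 < #|R|)%N -> (1 < #|~: R|)%N ->
  wcoord zbase (trans setT (pattern R t :|: pattern (~: R) t')) =
  1 + ((t == t') && (t != 2))%:R.
Proof.
move=> R1 R1'; rewrite zbase_trans.
have YR := pattern_sub R t; have YR' := pattern_sub (~: R) t'.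
have -> : (pattern R t :|: pattern (~: R) t' == setT) = (t == 0) && (t' == 0).
  rewrite -(pattern_full t R1) -(pattern_full t' R1').
  apply/eqP/andP => [e|[/eqP -> /eqP ->]]; last exact: setUCr.
  rewrite !eqEsubset YR YR' /=; split; apply/subsetP => l lR.
    have := in_setT l; rewrite -e inE => /orP[//|/(subsetP YR')].
    by rewrite inE lR.
  have := in_setT l; rewrite -e inE => /orP[/(subsetP YR)|//] h.
  by move: lR; rewrite inE h.
have -> : (pattern R t :|: pattern (~: R) t' == set0) = (t == 1) && (t' == 1).
  by rewrite setU_eq0 (pattern_empty t R1) (pattern_empty t' R1').
rewrite addrC; congr (_ + _).
by case: (ord3P t) => ->; case: (ord3P t') => ->; rewrite ?addr0 ?add0r.
Qed.

Section RankLowerBound.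
Variable s : nat.
Hypotheses (s3 : (3 <= s)%N) (sk : (2 * s <= k)%N).

Let rep_card (S : ksub k s) t : #|trans (val S) (pattern (val S) t)| == s.
Proof. by rewrite card_trans (valP S). Qed.

Let corep_card (S : ksub k s) t :
  #|trans (~: val S) (pattern (~: val S) t)| == (k - s)%N.
Proof.
have := cardsC (val S); rewrite card_trans card_ord (eqP (valP S)).
by move: #|~: val S| => m; clear; lia.
Qed.

Let rep S t : ksub n s := mk_ksub (rep_card S t).
Let corep S t : ksub n (k - s) := mk_ksub (corep_card S t).

(** Block diagonal in [S]: for distinct sets of equal size some block is hit by both sides, and the
    coordinate is zero. *)
Let rep_skset S S' t t' : skewflat zbase (rep S t) (corep S' t') =
  if S == S' then (-1) ^+ ninv (val S) (~: val S) * (1 + ((t == t') && (t != 2))%:R) else 0.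
Proof.
rewrite -[LHS]/(skset zbase (trans (val S) (pattern (val S) t))
   (trans (~: val S') (pattern (~: val S') t'))).
have [<-|SS] := eqVneq S S'.
  have d : [disjoint val S & ~: val S] by rewrite disjoints_subset setCK.
  have c1 : (1 < #|val S|)%N by rewrite (eqP (valP S)); lia.
  have c2 : (1 < #|~: val S|)%N.
    by have := cardsC (val S); rewrite card_ord (eqP (valP S)); lia.
  rewrite /skset ifT; last first.
    rewrite -setI_eq0; apply/eqP/setP => x; rewrite !inE; apply/negbTE/andP.
    move=> [/transP[l lS ->]]; rewrite mem_trans inE lS //.
  by rewrite ninv_trans // trans_setU ?pattern_sub // zbase_pattern.
have /subsetPn[l lS lS'] : ~~ (val S \subset val S').
  apply: contra SS => h; apply/eqP/val_inj/eqP; rewrite eqEcard h.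
  by rewrite (eqP (valP S)) (eqP (valP S')) leqnn.
rewrite /skset; case: ifP => // d; rewrite zbase_bad ?mulr0 //.
by apply: (bad_overlap (l := l) _ _ d); apply/hitsP;
  [exists (l \in pattern (val S) t) | exists (l \in pattern (~: val S') t')];
  rewrite mem_trans ?inE ?lS ?lS' eqxx.
Qed.

Let r := #|{: ksub k s * 'I_3}|.

Let P : 'M[F]_(r, #|{: ksub n s}|) := \matrix_(a, i)
  ((enum_val i == rep (enum_val a).1 (enum_val a).2)%:R -
   ((enum_val a).2 != 2)%:R * (enum_val i == rep (enum_val a).1 2)%:R).

Let Q : 'M[F]_(#|{: ksub n (k - s)}|, r) := \matrix_(i, a)
  ((enum_val i == corep (enum_val a).1 (enum_val a).2)%:R -
   ((enum_val a).2 != 2)%:R * (enum_val i == corep (enum_val a).1 2)%:R).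

Let pick_sum (T : finType) (f : T -> F) (x : T) :
  \sum_(i < #|{: T}|) (enum_val i == x)%:R * f (enum_val i) = f x.
Proof.
rewrite (bigD1 (enum_rank x)) //= enum_rankK eqxx mul1r big1 ?addr0 // => i ix.
rewrite (_ : (enum_val i == x) = false) ?mul0r //; apply/negbTE.
by apply: contra ix => /eqP <-; rewrite enum_valK.
Qed.

Lemma zbase_rank : exists (P : 'M[F]_(3 * 'C(k, s), #|{: ksub n s}|))
  (Q : 'M[F]_(#|{: ksub n (k - s)}|, 3 * 'C(k, s))),
  \det (P *m flatmx s zbase *m Q) != 0.
Proof.
have er : r = (3 * 'C(k, s))%N by rewrite /r card_prod card_ksub card_ord mulnC.
rewrite -er; exists P, Q.
have PQ a b : (P *m flatmx s zbase *m Q) a b =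
    if a == b then (-1) ^+ ninv (val (enum_val a).1) (~: val (enum_val a).1) else 0.
  pose g (S : ksub k s) t (B : ksub n (k - s)) : F :=
    skewflat zbase (rep S t) B - (t != 2)%:R * skewflat zbase (rep S 2) B.
  have PM c : (P *m flatmx s zbase) a c = g (enum_val a).1 (enum_val a).2 (enum_val c).
    rewrite mxE; under eq_bigr do rewrite !mxE.
    case: (enum_val a) => S0 t; rewrite /g /=.
    rewrite -(pick_sum (fun A : ksub n s => skewflat zbase A (enum_val c)) (rep S0 t)).
    rewrite -(pick_sum (fun A : ksub n s => skewflat zbase A (enum_val c)) (rep S0 2)).
    by rewrite mulr_sumr -sumrB; apply: eq_bigr => i _; rewrite mulrBl mulrA.
  rewrite mxE; under eq_bigr do rewrite PM mxE.
  rewrite -(inj_eq enum_val_inj).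
  move: (enum_val a) (enum_val b) => [S1 t] [S' t'] /=.
  transitivity (g S1 t (corep S' t') - (t' != 2)%:R * g S1 t (corep S' 2)).
    rewrite -(pick_sum (g S1 t) (corep S' t')) -(pick_sum (g S1 t) (corep S' 2)).
    by rewrite mulr_sumr -sumrB; apply: eq_bigr => i _; rewrite mulrC mulrBl mulrA.
  rewrite /g !rep_skset -[(S1, t) == _]/((S1 == S') && (t == t')).
  case: (S1 == S'); last by rewrite !(mulr0, subr0).
  set e := (-1) ^+ _.
  by case: (ord3P t) => ->; case: (ord3P t') => ->; rewrite /=; ring.
rewrite (_ : _ *m _ = diag_mx (\row_a (-1) ^+ ninv (val (enum_val a).1) (~: val (enum_val a).1))).
  rewrite det_diag; apply/prodf_neq0 => a _.
  by rewrite mxE signr_eq0.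
by apply/matrixP => a b; rewrite PQ !mxE mulrb.
Qed.

End RankLowerBound.

Lemma component_zbase s : (3 <= s)%N -> (2 * s <= k)%N ->
  irreducible_component (zclosure (@sum3_grass F n k)) (@minors_zero F n k s (3 * 'C(k, s)).+1).
Proof.
move=> s3 sk; have [P [Q dPQ]] := zbase_rank s3 sk.
apply: (flattening_component (z0 := zbase) dPQ).
- move=> w tw; have [N1 [N2 [N3 wE]]] := tangent_image s3 sk tw.
  have [g [Gg _ g0 g1]] := sum3_grass_curve (bmx th1) (bmx th2) (bmx th3) N1 N2 N3.
  exists g; split=> // X; last by rewrite g1 wE.
  by rewrite g0 !ffunE.
- by move=> z; apply: sum3_grass_minors_zero; lia.
- exists (plucker (bmx th1)), (plucker (bmx th2)), (plucker (bmx th3)).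
  by split=> //; eexists.
- exact: zirreducible_sum3.
Qed.

End Blocks.

Unset Implicit Arguments.

Theorem theorem10p1 (R : realType) (n k s : nat) :
  (2 * k <= n)%N -> (3 <= s)%N -> (2 * s <= k)%N ->
  irreducible_component (@sigma3_cone R[i] n k)
                        (@minors_zero R[i] n k s (3 * 'C(k, s) + 1)).
Proof. by move=> nk s3 sk; rewrite addn1; exact: component_zbase. Qed.
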